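(* For every $d\ge 2$ there is a constant $c=c(d)>0$ such that the following holds. Let $S=\mathbb{Z}^d$, and let $\mathcal{D}$ be a probability mass function on $\mathbb{N}\cup\{0\}$ such that $$\sum_{n=0}^{\infty}\left(1-\sum_{i=0}^{n}\mathcal{D}(i)\right)^{1/d}<c .$$ Let $P$ be a transition kernel on $S$ allowing only nearest neighbor jumps, and let $\{\eta_0(x)\}_{x\in\mathbb{Z}^d}$ be i.i.d. random variables with distribution $\mathcal{D}$ and joint law $\mathbf{P}$. Then for the ARW process with infinite sleep rate $\lambda=\infty$, $\mathbf{P}$-almost surely, $\eta=(S,\eta_0,P)$ is fixating. In particular, when $\lambda=\infty$, the critical density for the i.i.d. Poisson initial occupation on $\mathbb{Z}^d$ is positive for all dimensions $d$.
   Context: ARW process with infinite sleep rate. Given a triplet $\eta=(S,\eta_0,P)$ ($S$ a countable graph, $\eta_0:S\to\mathbb{N}\cup\{0\}$ a fixed initial occupation, $P$ a transition kernel on the vertices of $S$): at time $0$ there are $\eta_0(x)$ particles at each vertex $x$. At any time a particle is sleeping if it is alone at its vertex and active otherwise. Each particle has an independent rate one Poisson clock; when its clock rings and it is active, it jumps according to $P$, independently of everything else; sleeping particles do not move. The law is written $\mathbb{P}^{\eta}_{(\infty)}$. It is assumed throughout that $\eta_0$ and $P$ generate a well-defined ARW process on $S$ and that the probability of any local event measurable up to a finite time is the limit of its probabilities when $\eta_0$ is replaced by its restriction to finite sets $A_m$ increasing to $S$ (and by $0$ outside $A_m$). ''Only nearest neighbor jumps'' means that $P(x,y)>0$ only if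 $x,y$ are adjacent in $S$. Fixation. A vertex is fixating if from some finite time onward no active particle visits it, and nonfixating if no such time exists. $\eta$ is nonfixating if, $\mathbb{P}^{\eta}_{(\infty)}$-almost surely, all vertices are nonfixating; otherwise $\eta$ is fixating. Critical density. For $\mu\ge0$ take $\{\eta_0(x)\}_{x\in\mathbb{Z}^d}$ i.i.d. Poisson with mean $\mu$, and a kernel $P$ on $\mathbb{Z}^d$ allowing only nearest neighbor jumps. The critical density is the phase transition point in $\mu$ between fixation and nonfixation, i.e. the supremum of those $\mu$ such that for every density $\mu'\in(0,\mu)$ the triplet $(\mathbb{Z}^d,\eta_0,P)$ is almost surely fixating. *)

(* Defs.v *)
From HB Require Import structures.
From mathcomp Require Import all_boot all_order all_algebra.
From mathcomp Require Import finmap.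
From mathcomp Require Import all_classical all_reals all_analysis.

Set Implicit Arguments.
Unset Strict Implicit.
Unset Printing Implicit Defensive.

Import Order.TTheory GRing.Theory Num.Theory.
Import numFieldNormedType.Exports.

Local Open Scope classical_set_scope.
Local Open Scope ring_scope.

Definition mutually_independent (d : measure_display) (T : measurableType d)
    (R : realType) (Pr : probability T R) (I : choiceType)
    (F : I -> set (set T)) : Prop :=
  forall (s : seq I) (E : I -> set T), uniq s ->
    (forall i, i \in s -> F i (E i)) ->
    Pr (\bigcap_(i in [set` s]) E i) = (\prod_(i <- s) Pr (E i))%E.

Definition events_of (d d' : measure_display) (T : measurableType d)
    (T' : measurableType d') (X : T -> T') : set (set T) :=
  [set X @^-1` B | B in measurable].

Definition is_pmf (R : realType) (D : nat -> R) : Prop :=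
  (forall n, 0 <= D n) /\ (\sum_(0 <= n <oo) (D n)%:E = 1)%E.

Definition iid_pmf (d : measure_display) (T : measurableType d)
    (R : realType) (Pr : probability T R) (V : countType)
    (eta0 : V -> {RV Pr >-> nat}) (D : nat -> R) : Prop :=
  (forall x n, distribution Pr (eta0 x) [set n] = (D n)%:E) /\
  mutually_independent Pr (fun x => events_of (eta0 x)).

Definition transition_kernel (R : realType) (V : countType)
    (P : V -> V -> R) : Prop :=
  (forall x y, 0 <= P x y) /\
  (forall x, \esum_(y in [set: V]) (P x y)%:E = 1%E).

Definition nearest_neighbor (R : realType) (V : countType) (adj : rel V)
    (P : V -> V -> R) : Prop :=
  forall x y, 0 < P x y -> adj x y.

Definition zd_adj (d : nat) : rel 'rV[int]_d :=
  fun x y => \sum_(i < d) `|x 0 i - y 0 i| == 1.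

Section Dynamics.
Context {R : realType} {V : countType}.

(* The particle (x, i) is the one numbered i among those initially at x; it is
   present when i < eta x. Clocks and targets are attached to every pair (x, i),
   including those that carry no particle. *)
Local Notation particle := (V * nat)%type.

Definition present (eta : V -> nat) (p : particle) : Prop :=
  (p.2 < eta p.1)%N.

Definition ring_time (gap : particle -> nat -> R) (p : particle) (n : nat) : R :=
  \sum_(i < n.+1) gap p i.

Definition active (eta : V -> nat) (pos : particle -> R -> V) (t : R)
    (p : particle) : Prop :=
  present eta p /\
  exists q, [/\ present eta q, q <> p & pos q t = pos p t].

(* Whether a ringing particle jumps is decided by the left limits of the
   trajectories at the ring time [t]; [y] is the left limit of [p]. *)
Definition active_before (eta : V -> nat) (pos : particle -> R -> V) (t : R)
    (p : particle) (y : V) : Prop :=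
  exists q, [/\ present eta q, q <> p & \forall s \near t^'-, pos q s = y].

(* [target p n x] is the vertex to which [p] jumps if, at its [n]-th ring, it is
   active and located at [x]. *)
Definition arw_dynamics (eta : V -> nat) (gap : particle -> nat -> R)
    (target : particle -> nat -> V -> V) (pos : particle -> R -> V) : Prop :=
  forall p, present eta p ->
    (forall t, 0 <= t < ring_time gap p 0 -> pos p t = p.1) /\
    (forall n, exists y,
      [/\ \forall s \near (ring_time gap p n)^'-, pos p s = y,
          active_before eta pos (ring_time gap p n) p y ->
            forall t, ring_time gap p n <= t < ring_time gap p n.+1 ->
              pos p t = target p n y
        & ~ active_before eta pos (ring_time gap p n) p y ->
            forall t, ring_time gap p n <= t < ring_time gap p n.+1 ->
              pos p t = y]).

Definition particles_at (eta : V -> nat) (pos : particle -> R -> V) (t : R)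
    (x : V) : set particle :=
  [set p | present eta p /\ pos p t = x].

Definition occupation (eta : V -> nat) (pos : particle -> R -> V) (t : R)
    (x : V) : nat :=
  #|` fset_set (particles_at eta pos t x)|.

(* A particle that reaches an empty vertex falls asleep at once, so its arrival
   is not a visit by an active particle. A vertex receives at most one such
   arrival, because an occupied vertex never becomes empty. *)
Definition vertex_fixating (eta : V -> nat) (pos : particle -> R -> V)
    (x : V) : Prop :=
  exists t0, forall t, t0 <= t ->
    ~ exists p, active eta pos t p /\ pos p t = x.

Definition local_event (E : set (R -> V -> nat)) : Prop :=
  exists (t : R) (F : set V), finite_set F /\
    <<s [set [set xi : R -> V -> nat | xi sx.1 sx.2 = k] |
           sx in `[0, t] `*` F & k in [set: nat]] >> E.

End Dynamics.

(* A realisation of the process with sleep rate infinity started from [eta]: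
   rate one Poisson clocks are given by independent exponential gaps, and
   independent targets are drawn from [P] for every particle, ring and
   location. *)
Record arw_process (R : realType) (V : countType) (P : V -> V -> R)
    (eta : V -> nat) := ARWProcess {
  arw_display : measure_display;
  arw_space : measurableType arw_display;
  arw_prob : probability arw_space R;
  arw_gap : V * nat -> nat -> {RV arw_prob >-> R};
  arw_target : V * nat -> nat -> V -> arw_space -> V;
  arw_pos : V * nat -> R -> arw_space -> V;
  arw_gapE : forall p n B, measurable B ->
    distribution arw_prob (arw_gap p n) B = exponential_prob 1 B;
  arw_target_measurable : forall p n x y,
    measurable (arw_target p n x @^-1` [set y]);
  arw_targetE : forall p n x y,
    arw_prob (arw_target p n x @^-1` [set y]) = (P x y)%:E;
  arw_independent : mutually_independent arw_prob
    (fun k : (V * nat) * nat + (V * nat) * nat * V =>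
       match k with
       | inl (p, n) => events_of (arw_gap p n)
       | inr (p, n, x) => [set arw_target p n x @^-1` B | B in [set: set V]]
       end);
  arw_pos_measurable : forall p t x, present eta p -> 0 <= t ->
    measurable (arw_pos p t @^-1` [set x]);
  arw_dynamicsP : {ae arw_prob, forall w,
    arw_dynamics eta (fun p n => arw_gap p n w) (fun p n x => arw_target p n x w)
      (fun p t => arw_pos p t w)};
  arw_finite : {ae arw_prob, forall w, forall t x, 0 <= t ->
    finite_set (particles_at eta (fun p t => arw_pos p t w) t x)}
}.

Section Fixation.
Context {R : realType} {V : countType} (P : V -> V -> R).

Definition event_prob (eta : V -> nat) (Z : arw_process P eta)
    (E : set (R -> V -> nat)) : \bar R :=
  arw_prob Z [set w | E (occupation eta (fun p t => arw_pos (a := Z) p t w))].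

Definition restrict_to (A : set V) (eta : V -> nat) : V -> nat :=
  fun x => if x \in A then eta x else 0%N.

(* Started from a finite number of particles, the law of the process is unique,
   so the choice of the realisations [Zm] is immaterial. *)
Definition finite_volume_limit (eta : V -> nat) (Z : arw_process P eta) : Prop :=
  forall A : nat -> set V,
    (forall m, finite_set (A m)) -> (forall m, A m `<=` A m.+1) ->
    \bigcup_m A m = [set: V] ->
    exists Zm : forall m, arw_process P (restrict_to (A m) eta),
      forall E, local_event E ->
        event_prob (Zm m) E @[m --> \oo] --> event_prob Z E.

Definition well_defined (eta : V -> nat) : Prop :=
  exists Z : arw_process P eta, finite_volume_limit Z.

(* [finite_volume_limit] determines the law of the occupation process, hence
   [nonfixating] does not depend on the realisation [Z]. *)
Definition nonfixating (eta : V -> nat) : Prop :=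
  forall Z : arw_process P eta, finite_volume_limit Z ->
    {ae arw_prob Z, forall w, forall x,
      ~ vertex_fixating eta (fun p t => arw_pos (a := Z) p t w) x}.

Definition fixating (eta : V -> nat) : Prop := ~ nonfixating eta.

End Fixation.

Definition poisson_almost_surely (R : realType) (V : countType) (mu : R)
    (Q : (V -> nat) -> Prop) : Prop :=
  forall (dO : measure_display) (Omega : measurableType dO)
    (Pr : probability Omega R) (eta0 : V -> {RV Pr >-> nat}),
    iid_pmf eta0 (poisson_pmf mu) ->
    {ae Pr, forall w, Q (fun x => eta0 x w)}.

(* [poisson_pmf mu] is the Poisson law only for [mu > 0]. *)
Definition critical_density (R : realType) (V : countType)
    (P : V -> V -> R) : \bar R :=
  ereal_sup [set mu%:E | mu in [set mu : R | 0 <= mu /\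
    forall mu', 0 < mu' < mu -> poisson_almost_surely mu' (fixating P)]].

(* Main.v *)
(** Once occupied, a vertex stays occupied, and particles move along edges, so
    at time [T] every particle started in the occupied cluster [C] of the origin
    is still in [C], and conversely. As [C] is fully occupied,
    [#|C| <= \sum_(x in C) eta x]. For small tails this inequality fails for all
    large connected sets containing the origin, so the cluster stays bounded
    uniformly in time and volume, whereas nonfixation would fill a segment of
    any given length.

    The bound on lattice animals decomposes [eta] into the Bernoulli layers
    [eta x > k] of density [p]. At scale [2^i >= L ~ p^(-1/D)] an animal is
    toured by a walk that, sampled every [L] steps, has only [exp (O (2^i / L))]
    coarse shapes, and an exponential moment bounds the expected excess of its
    count over [O (2^i p^(1/D))]; below scale [L] the mean number of points in a
    cube is already small. Divided by [2^i] and summed over [i], these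
    expectations are [O (p^(1/D))], hence summable over the layers, and
    Borel-Cantelli applies along the dyadic scales. *)

Require Import Defs.
From HB Require Import structures.
From mathcomp Require Import all_boot all_order all_algebra.
From mathcomp Require Import finmap.
From mathcomp Require Import all_classical all_reals all_analysis.
From mathcomp Require Import measurable_realfun.
From mathcomp Require Import zify ring lra.

Set Implicit Arguments.
Unset Strict Implicit.
Unset Printing Implicit Defensive.

Import Order.TTheory GRing.Theory Num.Theory.
Import numFieldNormedType.Exports.

Local Open Scope classical_set_scope.
Local Open Scope ring_scope.

(** * Lattice animals and walks *)

Section Walks.
Context {V : eqType} (adj : rel V).
Hypothesis adj_sym : symmetric adj.

(** Inserting the excursion [y, z, y] at a visit to [y] adds [z] at the cost of two steps; this is
    the factor two in the length of a tour. *)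
Lemma walk_detour x s y z : path adj x s -> y \in x :: s -> adj y z ->
  exists s', [/\ path adj x s', size s' = (size s).+2 &
    x :: s' =i z :: x :: s].
Proof.
move=> xs ys yz; have zy : adj z y by rewrite adj_sym.
move: ys; rewrite inE => /predU1P[yx|ys].
  subst y; exists [:: z, x & s]; split => //=; first by rewrite yz zy.
  by move=> u; rewrite !inE; do 2 case: (_ == _).
case/splitPr: s / ys xs => s1 s2; rewrite cat_path /= => /and3P[xs1 ly ys2].
exists (s1 ++ [:: y, z, y & s2]); split.
- by rewrite cat_path /= xs1 ly yz zy.
- by rewrite !size_cat /= !addnS.
- move=> u; rewrite !(inE, mem_cat).
  by case: (u == x); case: (u == y); case: (u == z); rewrite ?orbT.
Qed.

(* A spanning tree of a finite connected set can be toured by a walk crossing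
   every edge twice; the tour is grown one vertex at a time. *)
Lemma covering_walk (O : V -> Prop) (K : nat) x : O x ->
    (forall s, uniq s -> (forall y, y \in s -> O y) -> (size s <= K)%N) ->
  exists s, [/\ path adj x s,
    (size s <= 2 * size (undup (x :: s)))%N,
    forall y, y \in x :: s -> O y &
    forall y z, y \in x :: s -> adj y z -> O z -> z \in x :: s].
Proof.
move=> Ox OK; apply: contrapT => H.
(* If no tour were closed under adjacency within [O], every tour could be extended, and the number
   of visited vertices would exceed [K]. *)
suff /(_ K.+1)[s [_ _ sO sK]] : forall m, exists s, [/\ path adj x s,
    (size s <= 2 * size (undup (x :: s)))%N,
    forall y, y \in x :: s -> O y & (m <= size (undup (x :: s)))%N].
  move: sK; rewrite ltnNge OK ?undup_uniq // => y.
  by rewrite mem_undup => /sO.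
elim=> [|m [s [xs s2 sO ms]]].
  by exists [::]; split => // y; rewrite inE => /eqP ->.
have /existsNP[y] : ~ (forall y z, y \in x :: s -> adj y z -> O z -> z \in x :: s).
  by move=> H'; apply: H; exists s.
move=> /existsNP[z] /not_implyP[ys] /not_implyP[yz] /not_implyP[Oz /negP zs].
have [s' [xs' s's s'z]] := walk_detour xs ys yz.
have E : size (undup (x :: s')) = (size (undup (x :: s))).+1.
  have -> : (size (undup (x :: s))).+1 = size (z :: undup (x :: s)) by [].
  apply: perm_size; apply: uniq_perm; first exact: undup_uniq.
    by rewrite /= -/(undup (x :: s)) mem_undup zs undup_uniq.
  by move=> u; rewrite mem_undup s'z [RHS]inE mem_undup inE.
exists s'; split; rewrite ?E //.
- by rewrite s's mulnS.
- by move=> u; rewrite s'z inE => /orP[/eqP -> //|/sO].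
Qed.

End Walks.

(** * Coarse-graining of lattice walks *)

Section CoarseGraining.
Context {d : nat}.
Local Notation V := 'rV[int]_d.

Lemma zd_adj_sym : symmetric (@zd_adj d).
Proof. by move=> x y; congr (_ == _); apply: eq_bigr => i _; rewrite distrC. Qed.

Lemma zd_adj_dist (x y : V) i : zd_adj x y -> `|x 0 i - y 0 i| <= 1.
Proof.
by move=> /eqP <-; rewrite (bigD1 i) //= lerDl sumr_ge0.
Qed.

Lemma walk_dist (x : V) s (y : V) i : path (@zd_adj d) x s -> y \in x :: s ->
  `|x 0 i - y 0 i| <= (size s)%:Z.
Proof.
elim: s x => [|z s IH] x /=; first by rewrite inE => _ /eqP ->; rewrite subrr.
move=> /andP[/(zd_adj_dist i) xz /IH zs].
rewrite inE => /predU1P[->|/zs zy]; first by rewrite subrr normr0.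
by rewrite (le_trans (ler_distD (z 0 i) _ _)) // intS lerD.
Qed.

Definition cube (a : V) (m : nat) : seq V :=
  [seq \row_i (a 0 i + (f i)%:Z) | f : {ffun 'I_d -> 'I_m}].

Lemma size_cube a m : size (cube a m) = (m ^ d)%N.
Proof. by rewrite size_image card_ffun !card_ord. Qed.

Lemma mem_cube (a : V) m (x : V) :
  (forall i, a 0 i <= x 0 i < a 0 i + m%:Z) -> x \in cube a m.
Proof.
move=> ax; have lt i : (absz (x 0%R i - a 0%R i)%R < m)%N by have := ax i; lia.
apply/fintype.imageP; exists [ffun i => Ordinal (lt i)] => //.
by apply/rowP => i; rewrite mxE ffunE /=; have := ax i; lia.
Qed.

Definition coarse (L : nat) (x : V) : V := \row_i (x 0%R i %/ L%:Z)%Z.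

(** The cell of [c] together with the cells around it, so that [L] steps from a point of the cell
    cannot leave it. *)
Definition block (L : nat) (c : V) : seq V :=
  cube (\row_i ((c 0 i - 1) * L%:Z)) (3 * L).

Fixpoint coarse_walks (L k : nat) (c : V) : seq (seq V) :=
  if k is k'.+1 then
    [seq block L c ++ U | c' <- cube (\row_i (c 0 i - 1)) 3,
                          U <- coarse_walks L k' c']
  else [:: block L c].

Lemma size_coarse_walks L k c : size (coarse_walks L k c) = ((3 ^ d) ^ k)%N.
Proof.
elim: k c => [|k IH] c //=; rewrite size_allpairs_dep.
under eq_map do rewrite IH.
by rewrite sumnE big_map big_const_seq count_predT size_cube iter_addn_0 expnS mulnC.
Qed.

Lemma size_coarse_walk L k c U :
  U \in coarse_walks L k c -> size U = (k.+1 * (3 * L) ^ d)%N.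
Proof.
elim: k c U => [|k IH] c U /=; first by rewrite inE => /eqP ->; rewrite size_cube mul1n.
by move=> /allpairsPdep[c' [U' [_ /IH U'k ->]]]; rewrite size_cat size_cube U'k -mulSn.
Qed.

Lemma near_block L (x y : V) : (0 < L)%N ->
  (forall i, `|x 0 i - y 0 i| <= L%:Z) -> y \in block L (coarse L x).
Proof.
move=> L0 xy; apply: mem_cube => i; rewrite !mxE.
have := xy i; have := divz_eq (x 0 i) L%:Z.
have := @ltz_pmod (x 0 i) L%:Z; have := @modz_ge0 (x 0 i) L%:Z.
by set q := (_ %/ _)%Z; set r := (_ %% _)%Z; nia.
Qed.

Lemma near_coarse L (x y : V) : (0 < L)%N ->
  (forall i, `|x 0 i - y 0 i| <= L%:Z) ->
  coarse L y \in cube (\row_i (coarse L x 0 i - 1)) 3.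
Proof.
move=> L0 xy; apply: mem_cube => i; rewrite !mxE.
have := xy i; have := divz_eq (x 0 i) L%:Z; have := divz_eq (y 0 i) L%:Z.
have := @ltz_pmod (x 0 i) L%:Z; have := @modz_ge0 (x 0 i) L%:Z.
have := @ltz_pmod (y 0 i) L%:Z; have := @modz_ge0 (y 0 i) L%:Z.
set q := (_ %/ _)%Z; set r := (_ %% _)%Z.
set q' := (_ %/ _)%Z; set r' := (_ %% _)%Z; nia.
Qed.

(* A walk sampled every [L] steps moves by at most one in coarse coordinates,
   so that a walk of length [k L] leaves only [(3^d)^k] possible coverings. *)
Lemma coarse_walk_cover L k (x : V) s : (0 < L)%N ->
  path (@zd_adj d) x s -> (size s <= k * L)%N ->
  exists2 U, U \in coarse_walks L k (coarse L x) & {subset x :: s <= U}.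
Proof.
move=> L0; elim: k x s => [|k IH] x s xs sk.
  exists (block L (coarse L x)); first by rewrite inE.
  move: s xs sk => [|? ?] // _ _ y; rewrite inE => /eqP ->.
  by apply: near_block => // i; rewrite subrr.
move: xs; rewrite -(cat_take_drop L s) cat_path => /andP[xt td].
have tL : (size (take L s) <= L)%N by rewrite size_take_min geq_minl.
have xtd y i : y \in x :: take L s -> `|x 0 i - y 0 i| <= L%:Z.
  by move=> /(walk_dist i xt) xy; rewrite (le_trans xy).
have [|U Uk dU] := IH _ _ td; first by rewrite size_drop; move: sk; rewrite mulSn; lia.
exists (block L (coarse L x) ++ U).
  apply/allpairsPdep; exists (coarse L (last x (take L s))), U; split => //.
  by apply: near_coarse => // i; apply: xtd; rewrite mem_last.
move=> y; rewrite -cat_cons !mem_cat => /orP[yt|yd].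
  by rewrite near_block // => i; exact: xtd.
by rewrite dU ?orbT // inE yd orbT.
Qed.

Lemma walk_cube n (x : V) s : path (@zd_adj d) x s -> (size s <= n)%N ->
  {subset x :: s <= cube (\row_i (x 0 i - n%:Z)) (2 * n).+1}.
Proof.
move=> xs sn y ys; apply: mem_cube => i; rewrite mxE.
by have := walk_dist i xs ys; move: (x 0 i) (y 0 i) => a b; lia.
Qed.

End CoarseGraining.

(** * Greedy lattice animals *)

Section BernoulliMoments.
Context {R : realType} {dT : measure_display} {T : measurableType dT}.
Context (Pr : probability T R) {I : choiceType} (B : I -> set T) (p : R).
Hypothesis mB : forall x, measurable (B x).
Hypothesis PB : forall s, uniq s ->
  Pr (\bigcap_(x in [set` s]) B x) = (p ^+ size s)%:E.

Lemma prod_indic_bigcap (s : seq I) w :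
  \prod_(x <- s) (\1_(B x) w : R) = \1_(\bigcap_(x in [set` s]) B x) w.
Proof.
rewrite bigcap_seq; elim: s => [|x s IH]; first by rewrite !big_nil indicE mem_setT.
by rewrite !big_cons IH indicI.
Qed.

Let prod_ge0 (s t : seq I) w :
  0 <= \prod_(x <- s) (1 + \1_(B x) w) * \prod_(x <- t) \1_(B x) w :> R.
Proof.
by rewrite mulr_ge0// prodr_ge0// => x _; rewrite ?addr_ge0// indicE ler0n.
Qed.

Let prod_meas (s t : seq I) : measurable_fun setT (fun w =>
  (\prod_(x <- s) (1 + \1_(B x) w) * \prod_(x <- t) \1_(B x) w)%:E : \bar R).
Proof.
apply/measurable_EFinP; apply: measurable_funM; apply: measurable_prod => x _.
  by apply: measurable_funD => //; exact: measurable_indic.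
exact: measurable_indic.
Qed.

(* As [2 ^ b = 1 + b] for a bit [b], the moment generating function of a count
   of independent events is a polynomial in intersection probabilities. *)
Lemma integral_prod_indic (s t : seq I) : uniq (s ++ t) ->
  (\int[Pr]_w (\prod_(x <- s) (1 + \1_(B x) w) * \prod_(x <- t) \1_(B x) w)%:E
   = ((1 + p) ^+ size s * p ^+ size t)%:E)%E.
Proof.
elim: s t => [|x s IH] t /= st.
  under eq_integral do rewrite big_nil mul1r prod_indic_bigcap.
  rewrite integral_indic//.
    by rewrite setIT mul1r; exact: PB.
  by apply: fin_bigcap_measurable => //; exact: finite_seq.
have /andP[xst ust] := st.
have uxt : uniq (s ++ x :: t).
  by rewrite -cat1s uniq_catCA cat1s.
(* Expanding the factor of [x] either drops [x] or moves it to [t]; the second product is there for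
   this induction. *)
under eq_integral => w _.
  have -> : \prod_(y <- x :: s) (1 + \1_(B y) w) * \prod_(y <- t) \1_(B y) w =
    \prod_(y <- s) (1 + \1_(B y) w) * \prod_(y <- t) \1_(B y) w +
    \prod_(y <- s) (1 + \1_(B y) w) * \prod_(y <- x :: t) \1_(B y) w :> R.
    by rewrite !big_cons; ring.
  rewrite EFinD; over.
rewrite ge0_integralD//=; last 2 first.
- by move=> w _; exact: prod_ge0.
- by move=> w _; exact: prod_ge0.
by rewrite !IH// -EFinD; congr _%:E; rewrite /= !exprS; ring.
Qed.

Lemma integral_prod1_indic (s : seq I) : uniq s ->
  (\int[Pr]_w (\prod_(x <- s) (1 + \1_(B x) w))%:E = ((1 + p) ^+ size s)%:E)%E.
Proof.
move=> us; have := @integral_prod_indic s [::].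
rewrite cats0 expr0 mulr1 => <- //; by apply: eq_integral => w _; rewrite big_nil mulr1.
Qed.

Lemma integral_sum_indic (s : seq I) :
  (\int[Pr]_w (\sum_(x <- s) \1_(B x) w)%:E = ((size s)%:R * p)%:E)%E.
Proof.
under eq_integral do rewrite -sumEFin.
rewrite ge0_integral_sum//; last first.
  by move=> x; apply/measurable_EFinP; exact: measurable_indic.
rewrite (eq_bigr (fun=> p%:E)).
  by rewrite sumEFin big_const_seq count_predT iter_addr_0 mulr_natl.
move=> x _; rewrite integral_indic// setIT.
by have := @PB [:: x] isT; rewrite set_cons1 bigcap_set1.
Qed.

(** If [N] is the count, the product is [2 ^ N], and an excess [N - a] is at most [2 ^ (N - a)].
    This turns an exponential moment into a bound on the mean excess over the threshold [a]. *)
Lemma sum_le_prod (s : seq I) (a : nat) w :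
  \sum_(x <- s) \1_(B x) w <= a%:R + \prod_(x <- s) (1 + \1_(B x) w) / 2 ^+ a :> R.
Proof.
have -> : \sum_(x <- s) \1_(B x) w = (count (fun x => w \in B x) s)%:R :> R.
  by elim: s => [|x s IH]; rewrite ?big_nil// big_cons IH indicE /= natrD.
have -> : \prod_(x <- s) (1 + \1_(B x) w) = 2 ^+ count (fun x => w \in B x) s :> R.
  elim: s => [|x s IH]; rewrite ?big_nil// big_cons IH indicE /= exprD.
  by case: (w \in B x); rewrite ?expr1 ?expr0 // addr0.
move: (count _ _) => N; have [Na|aN] := leqP N a.
  by rewrite (@le_trans _ _ a%:R) ?ler_nat// lerDl divr_ge0// exprn_ge0.
rewrite -expfB// -(subnKC (ltnW aN)) natrD lerD2l addKn.
by rewrite -natrX ler_nat ltnW// ltn_expl.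
Qed.

End BernoulliMoments.

Lemma ler_sum_uniq_sub (R : realDomainType) (I : eqType) (s t : seq I) (f : I -> R) :
  uniq s -> uniq t -> {subset s <= t} -> (forall x, 0 <= f x) ->
  \sum_(x <- s) f x <= \sum_(x <- t) f x.
Proof.
move=> us ut st f0; rewrite (perm_big [seq x <- t | x \in s]); last first.
  apply: uniq_perm; rewrite ?filter_uniq// => x; rewrite mem_filter.
  by apply/idP/andP => [xs|[]//]; split=> //; exact: st.
by rewrite big_filter big_mkcond ler_sum// => x _; case: ifP.
Qed.

Section DyadicBounds.
Context {R : realType}.

(** The power is at most [expR (M * x)], hence at most [expR 1]; the square root of the latter is at
    most two because [expR (- 1/2) >= 1/2]. *)
Lemma expr1D_le4 (x : R) M : 0 <= x -> M%:R * x <= 1 -> (1 + x) ^+ M <= 4.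
Proof.
move=> x0 Mx; have e2 : expR 2^-1 <= 2 :> R.
  have := @expR_ge1Dx R (- 2^-1); rewrite expRN => h.
  rewrite -[leLHS]invrK -[leRHS]invrK lef_pV2 ?posrE ?invr_gt0 ?expR_gt0//.
  by rewrite (le_trans _ h)//; lra.
apply: (@le_trans _ _ (expR x ^+ M)).
  by rewrite lerXn2r ?expR_ge1Dx// nnegrE ?expR_ge0// addr_ge0.
rewrite -expRM_natl (@le_trans _ _ (expR (2^-1 + 2^-1)))//.
  by rewrite ler_expR (le_trans Mx)//; lra.
rewrite expRD (_ : 4 = 2 * 2); last by lra.
by rewrite ler_pM ?expR_ge0.
Qed.

(** Applied to the [D]-th root [r] of the density, this selects the block side [2 ^ j], comparable
    to [1 / r]. *)
Lemma dyadic_scale (r : R) : 0 < r -> r <= 1 ->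
  exists j, r * 2 ^+ j <= 1 /\ 1 < r * 2 ^+ j.+1.
Proof.
move=> r0 r1; have : exists j, 1 < r * 2 ^+ j.+1.
  exists (Num.bound r^-1); rewrite mulrC -ltr_pdivrMr// mul1r.
  by apply: upper_nthrootP; rewrite leqnSn.
case/ex_minnP => -[|j] rj jmin; [exists 0%N|exists j.+1]; split=> //.
  by rewrite expr0 mulr1.
by rewrite leNgt; apply/negP => /jmin; rewrite ltnn.
Qed.

(** This is [2 ^ (- |i - j|)], the geometric decay on both sides of the block scale [j]. *)
Definition dyadic_gap j i : R :=
  if (i <= j)%N then 2 ^+ i / 2 ^+ j else 2 ^+ j / 2 ^+ i.

Lemma dyadic_gap_sum j N : \sum_(i < N) dyadic_gap j i <= 3.
Proof.
have pow_gt0 m : 0 < 2 ^+ m :> R by rewrite exprn_gt0.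
(* A bound that the induction reproduces: geometric growth up to [j], then a geometric tail
   increasing to three. *)
suff /le_trans : \sum_(i < N) dyadic_gap j i <=
    if (N <= j)%N then 2 ^+ N / 2 ^+ j else 3 - 2 * 2 ^+ j / 2 ^+ N.
  apply; case: ifP => Nj.
    rewrite ler_pdivrMr// (@le_trans _ _ (2 ^+ j))//.
      by rewrite ler_eXn2l// ltr1n.
    by rewrite ler_peMl ?(ltW (pow_gt0 _))// ler1n.
  by rewrite lerBlDr lerDl divr_ge0 ?mulr_ge0 ?(ltW (pow_gt0 _)).
elim: N => [|N IH]; first by rewrite big_ord0 leq0n divr_ge0// ltW.
rewrite big_ord_recr /=; apply: (le_trans (lerD IH (lexx _))).
rewrite /dyadic_gap; case: (ltngtP N j) => Nj.
- by rewrite exprS; lra.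
- rewrite exprS invfM.
  have -> : 2 * 2 ^+ j * (2^-1 / 2 ^+ N) = 2 ^+ j / 2 ^+ N :> R.
    by field; rewrite gt_eqF.
  by lra.
- rewrite Nj exprS invfM divff ?gt_eqF//.
  have -> : 2 * 2 ^+ j * (2^-1 / 2 ^+ j) = 1 :> R by field; rewrite gt_eqF.
  by lra.
Qed.

End DyadicBounds.

(** * Excess of one Bernoulli layer along walks *)

Section WalkExcess.
Context {R : realType} {dT : measure_display} {T : measurableType dT}.
Context (Pr : probability T R) {d : nat} (B : 'rV[int]_d -> set T) (p : R).
Hypothesis mB : forall x, measurable (B x).
Hypothesis PB : forall s, uniq s ->
  Pr (\bigcap_(x in [set` s]) B x) = (p ^+ size s)%:E.
Hypothesis p_ge0 : 0 <= p.

Let pow_gt0 m : 0 < 2 ^+ m :> R. Proof. by rewrite exprn_gt0. Qed.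

(** The term [4 * d] pays for the [(3 ^ d) ^ (2 * 2 ^ m)] coverings, using [3 <= 2 ^ 2]; the term
    [6 * 3 ^ d] pays for the exponential moment of the count in one covering. *)
Definition coarse_rate : nat := 4 * d + 6 * 3 ^ d.

(** A tour of at most [2 ^ i] vertices has length at most [2 ^ i.+1], which gives the radius. *)
Definition walk_range i : seq 'rV[int]_d :=
  cube (\row_l ((0 : 'rV[int]_d) 0 l - (2 ^ i.+1)%N%:Z)) (2 * 2 ^ i.+1).+1.

Definition cube_hits i w : R := \sum_(x <- walk_range i) \1_(B x) w.

Lemma cube_hits_bound i w s : path (@zd_adj d) 0 s -> (size s <= 2 ^ i.+1)%N ->
  \sum_(x <- undup (0 :: s)) \1_(B x) w <= cube_hits i w.
Proof.
move=> s0 si.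
apply: (@le_trans _ _ (\sum_(x <- undup (walk_range i)) \1_(B x) w)).
  apply: ler_sum_uniq_sub; rewrite ?undup_uniq// => x.
  by rewrite !mem_undup; exact: walk_cube.
rewrite /cube_hits; elim: (walk_range i) => [|x l IH] //=; case: ifP => _.
  by rewrite big_cons (le_trans IH)// lerDr.
by rewrite !big_cons lerD2l.
Qed.

Lemma integral_cube_hits i :
  (\int[Pr]_w (cube_hits i w)%:E = (((2 * 2 ^ i.+1).+1 ^ d)%:R * p)%:E)%E.
Proof. by rewrite /cube_hits (integral_sum_indic mB PB) size_cube. Qed.

(* [i = j + m] is the scale of the walk and [L = 2 ^ j] that of the blocks *)
Definition coarse_excess j m w : R :=
  \sum_(U <- coarse_walks (2 ^ j) (2 * 2 ^ m) (coarse (2 ^ j) (0 : 'rV[int]_d)))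
    (2 ^+ (coarse_rate * 2 ^ m))^-1 * \prod_(x <- undup U) (1 + \1_(B x) w).

Let prod_ge0 U w : 0 <= \prod_(x <- U) (1 + \1_(B x) w) :> R.
Proof. by rewrite prodr_ge0. Qed.

(** Some covering contains the walk, and its excess over the threshold is dominated by its own term
    of the sum: a union bound carried out before taking expectations. *)
Lemma coarse_excess_bound j m w s :
  path (@zd_adj d) 0 s -> (size s <= 2 ^ (j + m).+1)%N ->
  \sum_(x <- undup (0 :: s)) \1_(B x) w <=
    (coarse_rate * 2 ^ m)%:R + coarse_excess j m w.
Proof.
move=> s0 si; have L0 : (0 < 2 ^ j)%N by rewrite expn_gt0.
have [|U UW sU] := @coarse_walk_cover d _ (2 * 2 ^ m) _ _ L0 s0.
  by rewrite -mulnA -expnD -expnS addnC.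
apply: (@le_trans _ _ (\sum_(x <- undup U) \1_(B x) w)).
  apply: ler_sum_uniq_sub; rewrite ?undup_uniq// => x.
  by rewrite !mem_undup; exact: sU.
apply: (le_trans (sum_le_prod _ _ (coarse_rate * 2 ^ m) _)); rewrite lerD2l.
rewrite /coarse_excess (big_rem _ UW) /= mulrC lerDl sumr_ge0// => U' _.
by rewrite mulr_ge0// invr_ge0 ltW.
Qed.

(** The factor [2 ^ (- a)] compensates both the number of coverings and the moment of each one; the
    hypothesis says that a cell of side [2 ^ j] has mean count at most one. *)
Lemma integral_coarse_excess j m : p * (2 ^+ j) ^+ d <= 1 ->
  (\int[Pr]_w (coarse_excess j m w)%:E <= 1)%E.
Proof.
move=> pj; under eq_integral do rewrite /coarse_excess -sumEFin.
have mprod U : measurable_fun setT (fun w => \prod_(x <- U) (1 + \1_(B x) w) : R).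
  by apply: measurable_prod => x _; apply: measurable_funD => //; exact: measurable_indic.
rewrite ge0_integral_sum//; last 2 first.
- by move=> U; apply/measurable_EFinP; apply: measurable_funM.
- by move=> U w _; rewrite lee_fin mulr_ge0// invr_ge0 ltW.
set a := (coarse_rate * 2 ^ m)%N.
(* Bounds the number of cells of side [2 ^ j] in a covering: [2 * 2 ^ m + 1] blocks of [3 ^ d] cells
   each. *)
set N := (3 * 2 ^ m * 3 ^ d)%N.
have iU U : U \in coarse_walks (2 ^ j) (2 * 2 ^ m) (coarse (2 ^ j) (0 : 'rV[int]_d)) ->
    (\int[Pr]_w ((2 ^+ a)^-1 * \prod_(x <- undup U) (1 + \1_(B x) w))%:E <=
      ((2 ^+ a)^-1 * 4 ^+ N)%:E)%E.
  move=> /size_coarse_walk sU; under eq_integral do rewrite EFinM.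
  rewrite ge0_integralZl_EFin//; last 2 first.
  - by move=> w _; rewrite lee_fin.
  - exact/measurable_EFinP.
  rewrite (integral_prod1_indic mB PB) ?undup_uniq// -EFinM lee_fin.
  rewrite ler_pM2l ?invr_gt0//.
  apply: (@le_trans _ _ (((1 + p) ^+ ((2 ^ j) ^ d)) ^+ N)); last first.
    rewrite lerXn2r ?nnegrE ?exprn_ge0 ?addr_ge0// expr1D_le4//.
    by rewrite !natrX mulrC.
  rewrite -exprM ler_weXn2l ?lerDl// (leq_trans (size_undup _))// sU expnMn.
  rewrite mulnA [leqRHS]mulnC leq_mul// leq_mul//.
  by have := expn_gt0 2 m; lia.
set Us := coarse_walks _ _ _ in iU *.
apply: (@le_trans _ _ (\sum_(U <- Us) ((2 ^+ a)^-1 * 4 ^+ N)%:E)%E).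
  by rewrite big_seq [leRHS]big_seq; exact: lee_sum.
rewrite sumEFin big_const_seq count_predT size_coarse_walks iter_addr_0 lee_fin.
rewrite -[X in X <= _]mulr_natr -mulrA mulrC ler_pdivrMr// mul1r.
rewrite -(natrX _ 4 N) -(natrX _ 2 a) -natrM ler_nat.
have pow34 e : (3 ^ e <= 2 ^ (2 * e))%N.
  by rewrite expnM; case: e => // e; rewrite leq_exp2r.
rewrite (_ : 4 ^ N = 2 ^ (2 * N))%N; last by rewrite expnM.
rewrite -expnM (leq_trans (leq_mul (leqnn _) (pow34 _)))// -expnD leq_exp2l//.
by rewrite /a /N /coarse_rate; nia.
Qed.

End WalkExcess.

Section ScaledExcess.
Context {R : realType} {dT : measure_display} {T : measurableType dT}.
Context (Pr : probability T R) {d : nat} (B : 'rV[int]_d -> set T) (p : R) (D : nat).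
Hypothesis mB : forall x, measurable (B x).
Hypothesis PB : forall s, uniq s ->
  Pr (\bigcap_(x in [set` s]) B x) = (p ^+ size s)%:E.
Hypothesis p_ge0 : 0 <= p.
Hypothesis p_le1 : p <= 1.
Hypothesis D_ge2 : (2 <= D)%N.
Hypothesis d_le_D : (d <= D)%N.

Let r := p `^ D%:R^-1.

Let pow_gt0 m : 0 < 2 ^+ m :> R. Proof. by rewrite exprn_gt0. Qed.

Let rD : r ^+ D = p.
Proof.
by rewrite -powR_mulrn ?powR_ge0// /r -powRrM mulVf ?powRr1// pnatr_eq0; lia.
Qed.

(** [Z] counts a whole cube below the block scale [j] and is the coarse excess from [j] on. Divided
    by [2 ^ i], its mean decays geometrically away from [i = j], so the series is of order
    [2 ^ (- j)], and [2 ^ (- j) < 2 * r]. *)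
Lemma scaled_excess : exists Z : nat -> T -> R,
  [/\ forall i w, 0 <= Z i w,
      forall i, measurable_fun setT (Z i),
      forall i w s, path (@zd_adj d) 0 s -> (size s <= 2 ^ i.+1)%N ->
        \sum_(x <- undup (0 :: s)) \1_(B x) w <=
          (2 * coarse_rate (d := d))%:R * 2 ^+ i * r + Z i w &
      (\sum_(0 <= i <oo) ((2 ^+ i)^-1)%:E * \int[Pr]_w (Z i w)%:E
        <= (6 * 5 ^+ d * r)%:E)%E].
Proof.
have r0 : 0 <= r by exact: powR_ge0.
have mcube i : measurable_fun setT (cube_hits B i : T -> R).
  by apply: measurable_sum => x; exact: measurable_indic.
have cube0 i w : 0 <= cube_hits B i w :> R by rewrite sumr_ge0.
(* With [p = 0] no block scale exists, but the cube counts have mean zero. *)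
have [p0|pN0] := eqVneq p 0.
  exists (cube_hits B); split => //.
    move=> i w s s0 si; apply: (le_trans (cube_hits_bound _ _ s0 si)).
    by rewrite lerDr !mulr_ge0.
  rewrite eseries0 ?lee_fin ?mulr_ge0// => i _ _.
  by rewrite (integral_cube_hits mB PB) p0 mulr0 mule0.
have r_gt0 : 0 < r by rewrite powR_gt0// lt_neqAle eq_sym pN0.
have r1 : r <= 1.
  by rewrite -(@expr_le1 _ D) ?rD//; lia.
have [j [rj jr]] := dyadic_scale r_gt0 r1.
pose Z i := if (i < j)%N then cube_hits B i : T -> R else coarse_excess B j (i - j).
have Z0 i w : 0 <= Z i w.
  rewrite /Z; case: ifP => // _; rewrite sumr_ge0// => U _.
  by rewrite mulr_ge0 ?prodr_ge0// invr_ge0 ltW.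
have mZ i : measurable_fun setT (Z i).
  rewrite /Z; case: ifP => // _; apply: measurable_sum => U.
  apply: measurable_funM => //; apply: measurable_prod => x _.
  by apply: measurable_funD => //; exact: measurable_indic.
(* Follows from [r ^ D = p] and [r * 2 ^ j <= 1]. The case [e = d] is the mean count of a cell, the
   case [e = D] serves below the block scale. *)
have pj e : (e <= D)%N -> p * (2 ^+ j) ^+ e <= 1.
  move=> eD; rewrite -rD; apply: (@le_trans _ _ (r ^+ e * (2 ^+ j) ^+ e)).
    by rewrite ler_pM2r ?exprn_gt0// ler_wiXn2l.
  by rewrite -exprMn exprn_ile1// mulr_ge0// ltW.
exists Z; split => //.
  move=> i w s s0 si; rewrite /Z; case: ltnP => ij.
    apply: (le_trans (cube_hits_bound _ _ s0 si)).
    by rewrite lerDr !mulr_ge0// ltW.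
  apply: (@le_trans _ _ ((coarse_rate (d := d) * 2 ^ (i - j))%:R + coarse_excess B j (i - j) w)).
    by apply: coarse_excess_bound => //; rewrite subnKC.
  (* The extra factor two absorbs [2 ^ (- j) < 2 * r]. *)
  rewrite lerD2r !natrM natrX -!mulrA mulrCA ler_pM2l; last first.
    by rewrite ltr0n /coarse_rate addn_gt0 !muln_gt0 !expn_gt0 orbT.
  rewrite expfB_cond ?pnatr_eq0// ler_pdivrMr// exprS in jr *.
  by have := pow_gt0 i; nra.
have ZE i : (((2 ^+ i)^-1)%:E * \int[Pr]_w (Z i w)%:E <=
    (5 ^+ d * (2 ^+ j)^-1 * dyadic_gap j i)%:E)%E.
  rewrite /Z /dyadic_gap; case: (ltnP i j) => ij.
    rewrite (ltnW ij) (integral_cube_hits mB PB) -EFinM lee_fin.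
    have cube5 : ((2 * 2 ^ i.+1).+1 ^ d)%:R <= 5 ^+ d * 2 ^+ (i * d) :> R.
      rewrite exprM -exprMn natrX lerXn2r ?nnegrE ?mulr_ge0//.
      by rewrite -natrX -natrM ler_nat expnS; have := expn_gt0 2 i; lia.
    (* In exponents, [i * d + 2 * j <= j * D + 2 * i], that is [i * (d - 2) <= j * (D - 2)]: this
       uses [i < j], [d <= D] and [2 <= D]. *)
    have key : p * 2 ^+ (i * d) * (2 ^+ j * 2 ^+ j) <= 2 ^+ i * 2 ^+ i.
      apply: (@le_trans _ _ (p * (2 ^+ j) ^+ D * (2 ^+ i * 2 ^+ i))).
        rewrite -!mulrA ler_wpM2l// -exprM -!exprD ler_eXn2l ?ltr1n//.
        by clear -D_ge2 d_le_D ij; nia.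
      by rewrite ler_piMl ?mulr_ge0 ?(ltW (pow_gt0 _))// pj.
    apply: (@le_trans _ _ ((2 ^+ i)^-1 * (5 ^+ d * 2 ^+ (i * d) * p))).
      by rewrite ler_pM2l ?invr_gt0// ler_wpM2r.
    rewrite ler_pdivrMl//.
    have -> : 2 ^+ i * (5 ^+ d / 2 ^+ j * (2 ^+ i / 2 ^+ j)) =
        5 ^+ d * (2 ^+ i * 2 ^+ i / (2 ^+ j * 2 ^+ j)) :> R.
      by field; rewrite gt_eqF.
    rewrite -mulrA ler_wpM2l ?exprn_ge0// ler_pdivlMr ?mulr_gt0//.
    by rewrite (mulrC (2 ^+ (i * d))).
  have -> : (if (i <= j)%N then 2 ^+ i / 2 ^+ j else 2 ^+ j / 2 ^+ i) = 2 ^+ j / 2 ^+ i :> R.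
    by case: ifP => // ji; have -> : i = j by lia.
  rewrite (@le_trans _ _ ((2 ^+ i)^-1%:E * 1)%E)//.
    rewrite lee_pmul2l ?lte_fin ?invr_gt0//.
    exact: (integral_coarse_excess mB PB p_ge0 (i - j) (pj _ d_le_D)).
  rewrite mule1 lee_fin -mulrA mulKf ?gt_eqF// ler_peMl ?invr_ge0 ?(ltW (pow_gt0 _))//.
  by rewrite exprn_ege1// ler1n.
apply: (@le_trans _ _ (\sum_(0 <= i <oo) (5 ^+ d * (2 ^+ j)^-1 * dyadic_gap j i)%:E)%E).
  apply: lee_nneseries => i _; last exact: ZE.
  rewrite mule_ge0 ?lee_fin ?invr_ge0 ?(ltW (pow_gt0 _))// integral_ge0// => w _.
  by rewrite lee_fin.
have c0 : 0 <= 5 ^+ d * (2 ^+ j)^-1 :> R by rewrite mulr_ge0 ?exprn_ge0// invr_ge0 ltW.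
apply: lime_le.
  apply: is_cvg_nneseries => i _ _; rewrite lee_fin mulr_ge0// /dyadic_gap.
  by case: ifP => _; rewrite divr_ge0 ?ltW.
apply: nearW => N; rewrite sumEFin lee_fin -mulr_sumr big_mkord.
apply: (le_trans (ler_wpM2l c0 (dyadic_gap_sum j N))).
have -> : 5 ^+ d / 2 ^+ j * 3 = 5 ^+ d * (3 / 2 ^+ j) :> R by ring.
have -> : 6 * 5 ^+ d * r = 5 ^+ d * (6 * r) by ring.
rewrite ler_wpM2l ?exprn_ge0// ler_pdivrMr//.
by rewrite exprS in jr; lra.
Qed.

End ScaledExcess.

(** The final budget, with [q] the dyadic lower bound on the size of an animal: the part
    proportional to [r] takes at most [q / 2], and the excess [z] less than [q / 2]. *)
Lemma greedy_arith (R : realFieldType) (A c q r z : R) : 0 <= A -> 0 < q ->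
  A * c = 4^-1 -> r <= c -> z < 2 * q / 4 -> A * (2 * q) * r + z < q.
Proof.
move=> A0 q0 Ac rc zq; have : A * (2 * q) * r <= A * (2 * q) * c.
  by rewrite ler_wpM2l// mulr_ge0//; lra.
by rewrite (mulrAC A _ c) Ac; lra.
Qed.

(** * Lightness of all large animals *)

Section GreedyAnimals.
Context {R : realType} {d : nat}.
Local Notation V := 'rV[int]_d.

(* A connected set containing the origin is presented by a walk touring it. *)
Definition light (eta : V -> nat) (n : nat) : Prop :=
  forall s, path (@zd_adj d) 0 s ->
    (size s <= 2 * size (undup (0%R :: s)))%N ->
    (n <= size (undup (0%R :: s)))%N ->
    (\sum_(x <- undup (0%R :: s)) eta x < size (undup (0%R :: s)))%N.

(** A bound [K] on the total also bounds each value, so the layers from [K] on are empty. *)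
Lemma layer_cake (I : Type) (s : seq I) (eta : I -> nat) K :
  (\sum_(x <- s) eta x <= K)%N ->
  (\sum_(x <- s) eta x)%:R = \sum_(k < K) \sum_(x <- s) (k < eta x)%N%:R :> R.
Proof.
elim: s => [|x s IH]; first by rewrite big_nil big1// => k _; rewrite big_nil.
rewrite !big_cons => xK; under [RHS]eq_bigr do rewrite big_cons.
rewrite big_split natrD -IH; last by lia.
congr (_ + _); have {xK} : (eta x <= K)%N by lia.
move: (eta x) => n nK.
rewrite -(big_mkord xpredT (fun k => (k < n)%N%:R)) (big_cat_nat (leq0n n) nK)/=.
rewrite [X in _ + X]big_nat_cond [X in _ + X]big1 ?addr0; last first.
  by move=> k /andP[/andP[nk _] _]; rewrite ltnNge nk.
rewrite (eq_big_nat _ _ (F2 := fun=> 1)) => [|k /andP[_ ->]//].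
by rewrite sumr_const_nat subn0.
Qed.

Context (D : nat).
Hypothesis D_ge2 : (2 <= D)%N.
Hypothesis d_le_D : (d <= D)%N.

(** Chosen so that [2 * coarse_rate * greedy_const = 1/4], as [greedy_arith] requires. *)
Definition greedy_const : R := ((8 * coarse_rate (d := d))%N%:R)^-1.

Lemma greedy_const_gt0 : 0 < greedy_const.
Proof.
by rewrite invr_gt0 ltr0n /coarse_rate muln_gt0/= addn_gt0 !muln_gt0 !expn_gt0 orbT.
Qed.

Context {dO : measure_display} {Omega : measurableType dO}.
Context (Pr : probability Omega R) (eta0 : V -> {RV Pr >-> nat}) (pmf : nat -> R).
Hypothesis iid : iid_pmf eta0 pmf.

Let tail k : R := 1 - \sum_(i < k) pmf i.
Let B k x : set Omega := [set w | (k <= eta0 x w)%N].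

Let BE k x : B k x = eta0 x @^-1` [set n | (k <= n)%N]. Proof. by []. Qed.

Let mB k x : measurable (B k x).
Proof. by rewrite BE -[_ @^-1` _]setTI; exact: measurable_funPT. Qed.

Let PrB k x : Pr (B k x) = (tail k)%:E.
Proof.
elim: k => [|k IH].
  rewrite /tail big_ord0 subr0 (_ : B 0 x = setT) ?probability_setT//.
  by apply/seteqP; split => w.
have mk : measurable (eta0 x @^-1` [set k]).
  by rewrite -[_ @^-1` _]setTI; exact: measurable_funPT.
have E : B k x = (eta0 x @^-1` [set k]) `|` B k.+1 x.
  apply/seteqP; split => w; rewrite /B /=.
    by rewrite leq_eqVlt => /predU1P[->|]; [left|right].
  by move=> [->|/ltnW].
have disj : (eta0 x @^-1` [set k]) `&` B k.+1 x = set0.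
  by apply/seteqP; split => w //; rewrite /B /= => -[->]; rewrite ltnn.
have Pk : Pr (eta0 x @^-1` [set k]) = (pmf k)%:E by exact: iid.1 x k.
have : Pr (B k x) = (Pr (eta0 x @^-1` [set k]) + Pr (B k.+1 x))%E.
  by rewrite E; exact: measureU.
rewrite IH Pk.
have : Pr (B k.+1 x) \is a fin_num by rewrite fin_num_measure.
move: (Pr _) => [q| |]// _; rewrite -EFinD /tail big_ord_recr/= => -[] h.
by congr _%:E; lra.
Qed.

Let PrBI k (s : seq V) : uniq s ->
  Pr (\bigcap_(x in [set` s]) B k x) = (tail k ^+ size s)%:E.
Proof.
move=> us; rewrite (iid.2 s (B k))//; last by move=> x _; exists [set n | (k <= n)%N].
under eq_bigr do rewrite PrB.
by rewrite prodEFin big_const_seq count_predT iter_mulr_1.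
Qed.

Lemma light_ae :
  (\sum_(0 <= k <oo) ((tail k.+1) `^ (D%:R^-1))%:E < greedy_const%:E)%E ->
  {ae Pr, forall w, exists n, light (fun x => eta0 x w) n}.
Proof.
move=> sum_lt.
have tail01 k : 0 <= tail k <= 1.
  have := PrB k 0 => /esym E.
  by rewrite -!lee_fin E probability_le1// measure_ge0.
pose r k := tail k.+1 `^ D%:R^-1.
have r0 k : 0 <= r k by exact: powR_ge0.
have /choice[Z HZ] : forall k, exists Z : nat -> Omega -> R,
  [/\ forall i w, 0 <= Z i w,
      forall i, measurable_fun setT (Z i),
      forall i w s, path (@zd_adj d) 0 s -> (size s <= 2 ^ i.+1)%N ->
        \sum_(x <- undup (0 :: s)) \1_(B k.+1 x) w <=
          (2 * coarse_rate (d := d))%:R * 2 ^+ i * r k + Z i w &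
      (\sum_(0 <= i <oo) ((2 ^+ i)^-1)%:E * \int[Pr]_w (Z i w)%:E
        <= (6 * 5 ^+ d * r k)%:E)%E].
  move=> k; have /andP[t0 t1] := tail01 k.+1.
  exact: (scaled_excess (mB k.+1) (@PrBI k.+1) t0 t1 D_ge2 d_le_D).
have Z0 k i w : 0 <= Z k i w by have [] := HZ k.
have mZ k i : measurable_fun setT (EFin \o Z k i).
  by apply/measurable_EFinP; have [] := HZ k.
pose W i w : \bar R := (\sum_(0 <= k <oo) (Z k i w)%:E)%E.
have mW i : measurable_fun setT (W i).
  refine (@ge0_emeasurable_sum _ _ _ _ (fun k w => (Z k i w)%:E) xpredT _ _).
    by move=> k w _ _; rewrite lee_fin.
  by move=> k _; exact: mZ.
(* An animal with at least [2 ^ j] and fewer than [2 ^ j.+1] vertices is examined at scale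
   [i = j.+1], where [2 ^ i / 4] is half of [2 ^ j]. *)
pose Bad i : set Omega := [set w | ((2 ^+ i / 4)%:E <= W i w)%E].
have mBad i : measurable (Bad i).
  by rewrite -[Bad i]setTI; exact: emeasurable_fun_c_infty.
have PBad i : (Pr (Bad i) <=
    \sum_(0 <= k <oo) 4%:E * ((2 ^+ i)^-1%:E * \int[Pr]_w (Z k i w)%:E))%E.
  have pow_gt0 : 0 < 2 ^+ i :> R by rewrite exprn_gt0.
  have c0 : 0 <= 2 ^+ i / 4 :> R by rewrite divr_ge0 ?ltW.
  (* Markov's inequality; dividing by [2 ^ i] produces the weights of [scaled_excess]. *)
  have markov : ((2 ^+ i / 4)%:E * Pr (Bad i) <= \int[Pr]_w W i w)%E.
    rewrite -[Bad i]setIT -(integral_indic Pr measurableT (mBad i)).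
    rewrite -ge0_integralZl_EFin//; last first.
      by apply/measurable_EFinP; exact: measurable_indic.
    apply: ge0_le_integral => //.
      apply: emeasurable_funM => //.
      by apply/measurable_EFinP; exact: measurable_indic.
    move=> w _; rewrite indicE; case: (boolP (w \in Bad i)) => [|_].
      by rewrite inE mule1.
    by rewrite mule0; apply: nneseries_ge0 => k _ _; rewrite lee_fin.
  rewrite (integral_nneseries Pr measurableT (mZ^~ i)) in markov; last first.
    by move=> k w _; rewrite lee_fin.
  have i0 k : (0 <= \int[Pr]_w (Z k i w)%:E)%E.
    by apply: integral_ge0 => w _; rewrite lee_fin.
  rewrite nneseriesZl; last by move=> k _; rewrite mule_ge0// lee_fin invr_ge0 ltW.
  rewrite nneseriesZl// muleA -EFinM.
  rewrite -(@lee_pmul2l _ (2 ^+ i / 4)%:E)//.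
  rewrite muleA -EFinM (_ : 2 ^+ i / 4 * (4 * (2 ^+ i)^-1) = 1) ?mul1e//.
  by field; rewrite gt_eqF.
have lim0 : Pr (lim_sup_set Bad) = 0%E.
  apply: lim_sup_set_cvg0 => //.
  have t0 k i : (0 <= 4%:E * ((2 ^+ i)^-1%:E * \int[Pr]_w (Z k i w)%:E))%E.
    rewrite mule_ge0 ?lee_fin// mule_ge0 ?lee_fin ?invr_ge0 ?exprn_ge0//.
    by apply: integral_ge0 => w _; rewrite lee_fin.
  apply: (le_lt_trans (lee_nneseries _ (fun i _ => PBad i))) => //.
  (* Summing over the scales first leaves a multiple of [r k] for each layer, and these are summable
     by hypothesis. *)
  rewrite (nneseries_interchange xpredT xpredT) //.
  apply: (@le_lt_trans _ _ (\sum_(0 <= k <oo) (4 * (6 * 5 ^+ d))%:E * (r k)%:E)%E).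
    apply: lee_nneseries => k _; first by move=> _; apply: nneseries_ge0 => i _ _.
    rewrite nneseriesZl; last first.
      move=> i _; rewrite mule_ge0 ?lee_fin ?invr_ge0 ?exprn_ge0//.
      by apply: integral_ge0 => w _; rewrite lee_fin.
    by rewrite -EFinM -mulrA EFinM lee_pmul2l//; have [] := HZ k.
  rewrite nneseriesZl//; last by move=> k _; rewrite lee_fin.
  have : (\sum_(0 <= k <oo) (r k)%:E < greedy_const%:E)%E by [].
  have : (0 <= \sum_(0 <= k <oo) (r k)%:E)%E by apply: nneseries_ge0 => k _ _; rewrite lee_fin.
  case: (\sum_(0 <= k <oo) _)%E => [q| |]// _ _.
  by rewrite -EFinM ltry.
exists (lim_sup_set Bad); split => //.
  by apply: bigcap_measurable => // i _; apply: bigcup_measurable => j _.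
move=> w; apply: contra_notP => /= /existsNP[i0 /not_implyP[_ nbad]].
have {}nbad i : (i0 <= i)%N -> (W i w < (2 ^+ i / 4)%:E)%E.
  by move=> i0i; rewrite ltNge; apply/negP => bad; apply: nbad; exists i.
(* No scale from [i0] on is bad, and an animal with at least [2 ^ i0] vertices is examined only at
   such scales. *)
exists (2 ^ i0)%N => s s0 s2 su.
set l := undup _ in s2 su *; set u := size l in s2 su *.
have u_gt0 : (0 < u)%N by rewrite (leq_trans _ su)// expn_gt0.
have /andP[uj ju] := trunc_log_bounds (isT : (1 < 2)%N) u_gt0.
set j := trunc_log 2 u in uj ju.
have i0j : (i0 <= j.+1)%N.
  by apply: leqW; exact: trunc_log_max.
have si : (size s <= 2 ^ j.+2)%N by rewrite (leq_trans s2)// expnS leq_mul2l/= ltnW.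
have Wj := nbad _ i0j; rewrite -(ltr_nat R).
apply: (@lt_le_trans _ _ (2 ^ j)%:R); last by rewrite ler_nat.
rewrite (layer_cake (leqnn _)); set K := (\sum_(x <- l) _)%N.
have rK : \sum_(k < K) r k <= greedy_const.
  rewrite -lee_fin (le_trans _ (ltW sum_lt))// -sumEFin -(big_mkord xpredT (fun k => (r k)%:E)).
  by apply: nneseries_lim_ge => k _ _; rewrite lee_fin.
have ZK : \sum_(k < K) Z k j.+1 w < 2 ^+ j.+1 / 4.
  rewrite -lte_fin (le_lt_trans _ Wj)// -sumEFin -(big_mkord xpredT (fun k => (Z k j.+1 w)%:E)).
  by apply: nneseries_lim_ge => k _ _; rewrite lee_fin.
pose A : R := (2 * coarse_rate (d := d))%:R.
apply: (@le_lt_trans _ _ (\sum_(k < K) (A * 2 ^+ j.+1 * r k + Z k j.+1 w))).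
  apply: ler_sum => k _; have [_ _ /(_ _ w _ s0 si) + _] := HZ k.
  apply: le_trans; rewrite le_eqVlt; apply/orP; left; apply/eqP.
  by apply: eq_bigr => x _; rewrite indicE mem_setE.
rewrite big_split /= -mulr_sumr.
rewrite natrX exprS in ZK *; apply: (greedy_arith _ _ _ rK ZK); rewrite ?ler0n ?exprn_gt0//.
rewrite /A /greedy_const natrM [in X in _ * X]natrM invfM.
have c0 : (coarse_rate (d := d))%:R != 0 :> R.
  by have := greedy_const_gt0; rewrite invr_gt0 natrM pmulr_rgt0// => /gt_eqF ->.
by field.
Qed.

End GreedyAnimals.

(** * Poisson clocks *)

Section NoCoincidence.
Context {R : realType} {dT : measure_display} {T : measurableType dT}.
Context (Pr : probability T R) {I : choiceType} (X : I -> {RV Pr >-> R}).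
Hypothesis indep : mutually_independent Pr (fun i => events_of (X i)).
Hypothesis density_le1 : forall i a b, a <= b ->
  (Pr (X i @^-1` `[a, b]) <= (b - a)%:E)%E.
Context (e : I -> R).
Hypothesis e_unit : forall i, e i = 1 \/ e i = -1.

Let mX i (A : set R) : measurable A -> measurable (X i @^-1` A).
Proof. by move=> mA; rewrite -[_ @^-1` _]setTI; exact: measurable_funPT. Qed.

(** The sign condition lets the cells [[l * delta, l.+1 * delta[] with natural [l] cover all values
    of the summed variables. *)
Let window (i0 : I) (s : seq I) (u h : R) : set T :=
  [set w | X i0 w + \sum_(i <- s) e i * X i w \in `[u, u + h]] `&`
  \bigcap_(i in [set` s]) [set w | 0 <= X i w].

Let mwindow i0 s u h : measurable (window i0 s u h).
Proof.
apply: measurableI.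
  rewrite (_ : [set w | _] =
      (fun w => X i0 w + \sum_(i <- s) e i * X i w) @^-1` `[u, u + h]); last first.
    by apply/seteqP; split => w.
  rewrite -[_ @^-1` _]setTI.
  suff : measurable_fun setT (fun w => X i0 w + \sum_(i <- s) e i * X i w) by exact.
  apply: measurable_funD => //; apply: measurable_sum => i.
  exact: measurable_funM.
apply: fin_bigcap_measurable => // i _.
rewrite (_ : [set w | _] = X i @^-1` `[0, +oo[); first exact: mX.
by apply/seteqP; split => w /=; rewrite in_itv /= andbT.
Qed.

Let update (E : I -> set T) i A j := if j == i then A else E j.

Let bigcap_update E i A t : i \notin t ->
  \bigcap_(j in [set` i :: t]) update E i A j = A `&` \bigcap_(j in [set` t]) E j.
Proof.
move=> it; rewrite !bigcap_seq big_cons /update eqxx; congr (_ `&` _).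
by apply: eq_big_seq => j jt; case: eqP => // ji; rewrite -ji jt in it.
Qed.

(* The variables of [s] are conditioned one by one to lie in a cell of width
   [delta], which widens the window by [delta] each time. *)
Lemma window_le (delta : R) i0 (s : seq I) : 0 < delta ->
  forall (t : seq I) (E : I -> set T) u h, 0 <= h ->
  uniq (i0 :: s ++ t) -> (forall i, i \in t -> events_of (X i) (E i)) ->
  (Pr (window i0 s u h `&` \bigcap_(j in [set` t]) E j) <=
    (h + (size s)%:R * delta)%:E * Pr (\bigcap_(j in [set` t]) E j))%E.
Proof.
move=> delta0; elim: s => [|i s IH] t E u h h0.
  move=> /= /andP[i0t ut] tE; rewrite mul0r addr0.
  have -> : window i0 [::] u h = X i0 @^-1` `[u, u + h].
    rewrite /window set_nil bigcap_set0 setIT; apply/seteqP; split => w /=;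
    by rewrite big_nil addr0.
  rewrite -(bigcap_update E _ i0t) indep /=; last 2 first.
  - by rewrite i0t.
  - move=> j; rewrite inE /update => /predU1P[->|jt].
      by rewrite eqxx; exists `[u, u + h]%classic.
    by case: eqP => [->|_]; [exists `[u, u + h]%classic|exact: tE].
  rewrite big_cons {1}/update eqxx (eq_big_seq (fun j => Pr (E j))); last first.
    by move=> j jt; rewrite /update; case: eqP => // ji; rewrite -ji jt in i0t.
  rewrite -(indep ut tE) lee_wpmul2r//.
  by rewrite (le_trans (density_le1 _ _))// ?lerDl// addrAC subrr add0r.
move=> /= /andP[]; rewrite inE mem_cat !negb_or => /and3P[i0i i0s i0t].
rewrite mem_cat negb_or -andbA => /and3P[is' it /[dup] ust].
rewrite cat_uniq => /and3P[us _ ut] tE.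
pose cell l : set R := `[l%:R * delta, l.+1%:R * delta[%classic.
pose El l := update E i (X i @^-1` cell l).
(* Knowing [X i] up to [delta] moves the window according to the sign [e i]; for either sign the new
   width is [h + delta]. *)
pose u' l := if e i == 1 then u - l.+1%:R * delta else u + l%:R * delta.
have mE : measurable (\bigcap_(j in [set` t]) E j).
  by apply: fin_bigcap_measurable => // j /= /tE[A mA <-]; apply: mX.
have mF l : measurable (window i0 s (u' l) (h + delta) `&` \bigcap_(j in [set` i :: t]) El l j).
  apply: measurableI => //; rewrite bigcap_update//; apply: measurableI => //.
  by apply: mX; exact: measurable_itv.
have cover : window i0 (i :: s) u h `&` \bigcap_(j in [set` t]) E j `<=`
    \bigcup_l (window i0 s (u' l) (h + delta) `&` \bigcap_(j in [set` i :: t]) El l j).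
  move=> w [[/= wu wpos] wE].
  have Xi0 : 0 <= X i w by apply: wpos; rewrite /= inE eqxx.
  have /andP[le lt] := Num.Theory.truncn_itv (divr_ge0 Xi0 (ltW delta0)).
  set l := Num.truncn _ in le lt.
  rewrite ler_pdivlMr// in le; rewrite ltr_pdivrMr// in lt.
  exists l => //; split; last first.
    rewrite bigcap_update//; split => //.
    by rewrite /cell /= in_itv /= le lt.
  split; last by move=> j js; apply: wpos; rewrite /= inE js orbT.
  move: wu; rewrite /= big_cons !in_itv /= /u'; case: (e_unit i) => ->.
    rewrite eqxx => /andP[h1 h2]; apply/andP; split; lra.
  have -> : (-1 == 1 :> R) = false by apply/eqP; lra.
  by move=> /andP[h1 h2]; apply/andP; split; lra.
apply: (le_trans (measure_sigma_subadditive Pr mF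
  (measurableI _ _ (mwindow i0 (i :: s) u h) mE) cover)).
have step l : (Pr (window i0 s (u' l) (h + delta) `&` \bigcap_(j in [set` i :: t]) El l j) <=
    (h + (size s).+1%:R * delta)%:E * Pr (X i @^-1` cell l `&` \bigcap_(j in [set` t]) E j))%E.
  rewrite -(bigcap_update E _ it).
  have -> : h + (size s).+1%:R * delta = h + delta + (size s)%:R * delta.
    by rewrite -natr1; ring.
  apply: IH; first by rewrite addr_ge0// ltW.
  - rewrite cons_uniq mem_cat inE !negb_or i0i i0s i0t -cat1s uniq_catCA cat1s /=.
    by rewrite mem_cat negb_or is' it.
  - move=> j; rewrite inE /El /update; case: eqP => [-> _|_ /= /tE//].
    by exists (cell l) => //; exact: measurable_itv.
apply: (le_trans (lee_nneseries _ (fun l _ => step l))) => //.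
have c0 : 0 <= h + (size s).+1%:R * delta by rewrite addr_ge0// mulr_ge0// ltW.
rewrite nneseriesZl// lee_wpmul2l ?lee_fin//.
(* The cells are disjoint, so their probabilities sum to at most that of the conditioning event. *)
pose F l := X i @^-1` cell l `&` \bigcap_(j in [set` t]) E j.
have mFl l : measurable (F l).
  by apply: measurableI => //; apply: mX; exact: measurable_itv.
have trivF : trivIset setT F.
  apply/trivIsetP => l m _ _ lm; rewrite -subset0 => w [[wl _] [wm _]].
  move: wl wm; rewrite /cell /= !in_itv /= => /andP[l1 l2] /andP[m1 m2].
  have := le_lt_trans l1 m2; have := le_lt_trans m1 l2.
  rewrite !ltr_pM2r// !ltr_nat !ltnS => ml lm'.
  by move: lm; rewrite eqn_leq ml lm'.
have -> : (\sum_(0 <= l <oo) Pr (F l) = Pr (\bigcup_l F l))%E.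
  by rewrite measure_bigcup//; apply: eq_eseriesl => l; rewrite in_setT.
apply: le_measure; rewrite ?inE//.
- by apply: bigcup_measurable.
- by move=> w [l _ []].
Qed.

(** By [window_le], a window of width zero has probability at most [size s * delta] for every
    [delta > 0]. *)
Lemma no_coincidence i0 (s : seq I) : uniq (i0 :: s) ->
  (forall i, {ae Pr, forall w, 0 <= X i w}) ->
  {ae Pr, forall w, X i0 w + \sum_(i <- s) e i * X i w != 0}.
Proof.
move=> us Xpos.
have window0 : Pr (window i0 s 0 0) = 0%E.
  apply/eqP; rewrite eq_le measure_ge0 andbT; apply/lee_addgt0Pr => eps eps0.
  pose delta := eps / (size s).+1%:R.
  have delta0 : 0 < delta by rewrite divr_gt0.
  have := @window_le delta i0 s delta0 [::] (fun=> setT) 0 0 (lexx _).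
  rewrite cats0 set_nil bigcap_set0 setIT probability_setT mule1 add0r add0e.
  move=> /(_ us) h; apply: (le_trans (h _)) => //; rewrite lee_fin /delta.
  by rewrite mulrCA ger_pMr// ler_pdivrMr// mul1r ler_nat.
have spos : {ae Pr, forall w, forall i, i \in s -> 0 <= X i w}.
  elim: s {us window0} => [|i s IH]; first by apply: aeW.
  apply: filterS2 (Xpos i) IH => w iw sw j.
  by rewrite inE => /predU1P[->|/sw].
have nw : {ae Pr, forall w, ~ window i0 s 0 0 w}.
  exists (window i0 s 0 0); split => // w /=; exact: contrapT.
apply: filterS2 nw spos => w nw sw; apply/eqP => E; apply: nw; split.
  by rewrite /= E in_itv /= addr0 lexx.
by move=> i /sw.
Qed.

End NoCoincidence.

Section ExponentialLaw.
Context {R : realType}.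

Lemma exponential_pdf1_le1 (x : R) : exponential_pdf 1 x <= 1.
Proof.
have [x0|x0] := ltP x 0; first by rewrite lt0_exponential_pdf.
by rewrite exponential_pdfE//= mul1r expR_le1 mulN1r oppr_le0.
Qed.

Lemma exponential_prob1_itv (a b : R) : a <= b ->
  (exponential_prob 1 `[a, b] <= (b - a)%:E)%E.
Proof.
move=> ab; rewrite /exponential_prob.
apply: (@le_trans _ _ (\int[lebesgue_measure]_(x in `[a, b]) (cst 1%:E x))%E).
  apply: ge0_le_integral => //.
  - by move=> x _; rewrite lee_fin exponential_pdf_ge0.
  - apply/measurable_EFinP; apply: measurable_funTS.
    exact: measurable_exponential_pdf.
  - by move=> x _; rewrite lee_fin exponential_pdf1_le1.
rewrite integral_cst//.
rewrite mul1e [leLHS](@lebesgue_measure_itv R `[a, b]) /= lte_fin.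
by case: ltP => // _; rewrite lee_fin subr_ge0.
Qed.

Lemma exponential_prob1_neg : exponential_prob 1 `]-oo, (0 : R)[ = 0%E.
Proof.
rewrite /exponential_prob; apply: integral0_eq => x.
by rewrite /= in_itv /= => x0; rewrite lt0_exponential_pdf.
Qed.

End ExponentialLaw.

Lemma ae_forall_countable {d : measure_display} {T : measurableType d} {R : realType}
    (Pr : probability T R) {I : countType} (Q : I -> T -> Prop) :
  (forall i, {ae Pr, forall w, Q i w}) -> {ae Pr, forall w, forall i, Q i w}.
Proof.
move=> Qae; have : {ae Pr, forall w, forall n,
    if (choice.unpickle n : option I) is Some i then Q i w else True}.
  by apply/ae_foralln => n; case: (choice.unpickle n : option I) => [i|]; [exact: Qae|exact: aeW].
by apply: filterS => w Qw i; have := Qw (choice.pickle i); rewrite choice.pickleK.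
Qed.

(** * Almost sure properties of the clocks *)

Section Clocks.
Context {R : realType} {V : countType} {P : V -> V -> R} {eta : V -> nat}.
Context (Z : arw_process P eta).
Local Notation Pr := (arw_prob Z).
Local Notation gap := (arw_gap Z).

Let X (k : (V * nat) * nat) : {RV Pr >-> R} := gap k.1 k.2.

Let mX k (A : set R) : measurable A -> measurable (X k @^-1` A).
Proof. by move=> mA; rewrite -[_ @^-1` _]setTI; exact: measurable_funPT. Qed.

Let indepX : mutually_independent Pr (fun k => events_of (X k)).
Proof.
move=> s E us sE.
pose E' (k : (V * nat) * nat + (V * nat) * nat * V) := if k is inl k' then E k' else setT.
have inl_inj : injective (@inl ((V * nat) * nat) ((V * nat) * nat * V)).
  by move=> x y [].
have := @arw_independent _ _ _ _ Z (map inl s) E'.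
rewrite map_inj_uniq// => /(_ us); rewrite bigcap_seq big_map -bigcap_seq big_map; apply.
by move=> k /mapP[[p n] ks ->]; exact: sE ks.
Qed.

Let PrX k (A : set R) : measurable A -> Pr (X k @^-1` A) = exponential_prob 1 A.
Proof. by move=> mA; exact: arw_gapE. Qed.

Let PrX_itv k a b : a <= b -> (Pr (X k @^-1` `[a, b]) <= (b - a)%:E)%E.
Proof. by move=> ab; rewrite PrX// exponential_prob1_itv. Qed.

Lemma gap_gt0 : {ae Pr, forall w, forall p n, 0 < gap p n w}.
Proof.
suff : {ae Pr, forall w, forall k, 0 < X k w}.
  by apply: filterS => w Xw p n; exact: Xw (p, n).
apply: ae_forall_countable => k.
have null A : measurable A -> Pr (X k @^-1` A) = 0%E -> Pr.-negligible (X k @^-1` A).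
  by move=> mA A0; exists (X k @^-1` A); split => //; exact: mX.
have neg : Pr (X k @^-1` `]-oo, 0[) = 0%E by rewrite PrX// exponential_prob1_neg.
have zero : Pr (X k @^-1` `[0, 0]) = 0%E.
  by apply/eqP; rewrite eq_le measure_ge0 andbT (le_trans (PrX_itv _ _))// subrr.
apply: negligibleS (negligibleU (null _ _ neg) (null _ _ zero)) => //.
move=> w /= /negP; rewrite -leNgt le_eqVlt => /predU1P[->|X0].
  by right; rewrite /= in_itv /= lexx.
by left; rewrite /= in_itv.
Qed.

(** A gap is at most [1/2] with probability at most [1/2], so [m] independent gaps all are with
    probability at most [2 ^ (- m)]. Gaps above [1/2] recur forever, which excludes explosion of a
    clock. *)
Lemma gap_large : {ae Pr, forall w, forall p K, exists n, (K <= n)%N /\ 2^-1 < gap p n w}.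
Proof.
suff : {ae Pr, forall w, forall pK : (V * nat) * nat,
    exists n, (pK.2 <= n)%N /\ ~ X (pK.1, n) w \in `[0, 2^-1]}.
  apply: filterS2 gap_gt0 => w w0 Xw p K; have [n [Kn nX]] := Xw (p, K).
  exists n; split => //; rewrite ltNge; apply/negP => n2; apply: nX.
  by rewrite in_itv /= n2 andbT; exact/ltW/w0.
apply: ae_forall_countable => -[p K] /=.
pose small n := X (p, n) @^-1` `[0, 2^-1].
have msmall n : measurable (small n) by apply: mX; exact: measurable_itv.
exists (\bigcap_(n in [set n | (K <= n)%N]) small n); split.
- by apply: bigcap_measurable => //; exists K => /=.
- apply/eqP; rewrite eq_le measure_ge0 andbT.
  have le m : (Pr (\bigcap_(n in [set n | (K <= n)%N]) small n) <= ((2^-1) ^+ m)%:E)%E.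
    pose s := [seq (p, n) | n <- iota K m].
    apply: (@le_trans _ _ (Pr (\bigcap_(k in [set` s]) X k @^-1` `[0, 2^-1]))).
      apply: le_measure; rewrite ?inE//.
      - by apply: bigcap_measurable => //; exists K => /=.
      - by apply: fin_bigcap_measurable => // k _; apply: mX; exact: measurable_itv.
      by move=> w ws _ /mapP[n + ->]; rewrite mem_iota => /andP[Kn _]; exact: ws.
    rewrite indepX; last 2 first.
    - by rewrite map_inj_uniq ?iota_uniq// => x y [].
    - by move=> k _; exists `[0, 2^-1]%classic.
    rewrite big_map -{2}(size_iota K m); elim: (iota K m) => [|n l IH] /=.
      by rewrite big_nil expr0.
    rewrite big_cons exprS EFinM lee_pmul//.
      by apply: prode_ge0 => j _.
    by rewrite (le_trans (PrX_itv _ _))// subr0.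
  apply/lee_addgt0Pr => eps eps0; rewrite add0e.
  have [m me] : exists m, (2^-1) ^+ m < eps.
    exists (Num.bound eps^-1); rewrite exprVn -[ltRHS]invrK ltf_pV2 ?posrE ?exprn_gt0 ?invr_gt0//.
    exact: upper_nthrootP.
  by rewrite (le_trans (le m))// lee_fin ltW.
- move=> w /= nE n /= Kn; apply: contrapT => nw; apply: nE; exists n; split => //.
Qed.

Lemma ring_unbounded : {ae Pr, forall w, forall p M,
  exists n, M < ring_time (fun p n => gap p n w) p n}.
Proof.
apply: filterS2 gap_gt0 gap_large => w w0 wl p M.
have incr n m : (n <= m)%N ->
    ring_time (fun p n => gap p n w) p n <= ring_time (fun p n => gap p n w) p m.
  move=> /subnK <-; elim: (m - n)%N => [|k IH]; first by rewrite add0n.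
  by rewrite (le_trans IH)// addSn /ring_time [leRHS]big_ord_recr lerDl ltW.
have half (j : nat) : exists n, j%:R / 2 <= ring_time (fun p n => gap p n w) p n.
  elim: j => [|j [n IH]].
    by exists 0%N; rewrite mul0r /ring_time sumr_ge0// => i _; exact/ltW/w0.
  have [m [nm mw]] := wl p n.+1; exists m; case: m => // m in nm mw *.
  rewrite /ring_time [leRHS]big_ord_recr -natr1 mulrDl mul1r lerD//; last exact: ltW.
  by apply: (le_trans IH); exact: (incr n m nm).
have [n nM] := half (2 * Num.bound `|M|)%N; exists n; apply: lt_le_trans nM.
rewrite natrM mulrAC divff// mul1r (le_lt_trans (ler_norm M))//.
exact: archi_boundP.
Qed.

Lemma ring_distinct : {ae Pr, forall w, forall p q n m, p <> q ->
  ring_time (fun p n => gap p n w) p n <> ring_time (fun p n => gap p n w) q m}.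
Proof.
suff : {ae Pr, forall w, forall k : (V * nat) * (V * nat) * (nat * nat), k.1.1 <> k.1.2 ->
    ring_time (fun p n => gap p n w) k.1.1 k.2.1 <>
    ring_time (fun p n => gap p n w) k.1.2 k.2.2}.
  by apply: filterS => w Xw p q n m pq; exact: (Xw (p, q, (n, m))).
apply: ae_forall_countable => -[[p q] [n m]] /=.
have [->|/eqP pq] := eqVneq p q; first by apply: aeW.
pose e (k : (V * nat) * nat) : R := if k.1 == p then 1 else -1.
(* With signs [e], the gap [(p, 0)] and the gaps in [s] sum to the difference of the two ring times;
   ring number [n] is the sum of [n.+1] gaps. *)
pose s := [seq (p, i.+1) | i <- iota 0 n] ++ [seq (q, j) | j <- iota 0 m.+1].
have us : uniq ((p, 0%N) :: s).
  rewrite /= mem_cat cat_uniq !map_inj_uniq ?iota_uniq; last 2 first.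
  - by move=> x y [].
  - by move=> x y [].
  rewrite !andbT negb_or -!andbA; apply/and3P; split.
  - by apply/negP => /mapP[i _ []].
  - by apply/negP => /mapP[i _ [/pq]].
  - by apply/hasPn => k /mapP[j _ ->]; apply/negP => /mapP[i _ [/esym/pq]].
have e_unit k : e k = 1 \/ e k = -1 by rewrite /e; case: ifP; [left|right].
have X0 k : {ae Pr, forall w, 0 <= X k w}.
  by apply: filterS gap_gt0 => w w0; exact/ltW/w0.
have := @no_coincidence _ _ _ Pr _ X indepX PrX_itv e e_unit _ _ us X0.
apply: filterS => w + _ => /eqP; apply: contra_not.
have iotaE (F : nat -> R) k : \sum_(i <- iota 0 k) F i = \sum_(i < k) F i.
  by rewrite -(big_mkord xpredT F) /index_iota subn0.
rewrite /ring_time big_ord_recl => E.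
rewrite /s big_cat !big_map !iotaE /= addrA.
under eq_bigr do rewrite /e eqxx mul1r.
under [X in _ + X]eq_bigr do rewrite /e (introF eqP (nesym pq)) mulN1r.
by rewrite sumrN -E subrr.
Qed.

Lemma target_adj (adj : rel V) : transition_kernel P -> nearest_neighbor adj P ->
  {ae Pr, forall w, forall p n x, adj x (arw_target (a := Z) p n x w)}.
Proof.
move=> [P0 _] Padj.
suff : {ae Pr, forall w, forall k : (V * nat) * nat * V * V,
    arw_target (a := Z) k.1.1.1 k.1.1.2 k.1.2 w = k.2 -> adj k.1.2 k.2}.
  by apply: filterS => w Xw p n x; exact: (Xw (p, n, x, _)).
apply: ae_forall_countable => -[[[p n] x] y] /=.
have [xy|nxy] := boolP (adj x y); first exact: aeW.
exists (arw_target (a := Z) p n x @^-1` [set y]); split.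
- exact: arw_target_measurable.
- rewrite arw_targetE; congr _%:E; apply/eqP; rewrite eq_le P0 andbT leNgt.
  by apply/negP => /Padj; exact/negP.
- by move=> w /= H; apply: contrapT => ne; apply: H => /ne.
Qed.

End Clocks.

(** * Occupied clusters *)

(** Continuous induction: the supremum of the times up to which [Q] holds throughout satisfies [Q]
    and cannot lie below [b]. It replaces an ordering of all ring times. *)
Lemma real_induction (R : realType) (Q : R -> Prop) a b : a <= b -> Q a ->
  (forall u, a <= u < b -> Q u -> exists2 v, u < v & forall s, u <= s < v -> Q s) ->
  (forall u, a < u <= b -> (forall s, a <= s < u -> Q s) -> Q u) ->
  Q b.
Proof.
move=> ab Qa right left.
pose S : set R := [set u | a <= u <= b /\ forall s, a <= s <= u -> Q s].
have Sa : S a by split => [|s]; [rewrite lexx|rewrite -eq_le => /eqP <-].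
have hS : has_sup S by split; [exists a|exists b => u [/andP[]]].
pose m := sup S; have am : a <= m by exact: ub_le_sup hS.2 _ Sa.
have mb : m <= b by apply: ge_sup; [exists a|move=> u [/andP[]]].
have below s : a <= s < m -> Q s.
  move=> /andP[as_ sm]; have := sup_adherent (eps := m - s) _ hS.
  rewrite subr_gt0 sm => /(_ isT)[u [_ Qu]]; rewrite -/m => mu.
  by apply: Qu; rewrite as_ ltW//; lra.
have Qm : Q m.
  have [ma|ma] := leP m a; first by have -> : m = a by apply/eqP; rewrite eq_le ma am.
  by apply: left => //; rewrite ma.
have [bm|mltb] := leP b m; first by have <- : m = b by apply/eqP; rewrite eq_le bm mb.
have [|v mv Qv] := right m _ Qm; first by rewrite am.
pose u := Num.min b ((m + v) / 2).
have mu : m < u by rewrite lt_min mltb; lra.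
suff /(ub_le_sup hS.2) : S u by rewrite leNgt mu.
have uv : u < v by rewrite gt_min; apply/orP; right; lra.
split; first by rewrite (le_trans am (ltW mu)) ge_min lexx.
move=> s /andP[as_ su]; have [sm|ms] := ltP s m; first by apply: below; rewrite as_.
by apply: Qv; rewrite ms (le_lt_trans su).
Qed.

Lemma at_left_ex2 (R : realType) (u : R) (P Q : R -> Prop) :
  (\forall s \near u^'-, P s) -> (\forall s \near u^'-, Q s) ->
  exists s, P s /\ Q s.
Proof.
by move=> Pu Qu; apply: (@filter_ex _ (u^'-)); apply: filterS2 Pu Qu => s; split.
Qed.

Section Trajectories.
Context {R : realType} {V : countType}.
Context (eta : V -> nat) (gap : V * nat -> nat -> R).
Context (target : V * nat -> nat -> V -> V) (pos : V * nat -> R -> V).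
Hypothesis gap0 : forall p n, 0 < gap p n.
Hypothesis unbounded : forall p M, exists n, M < ring_time gap p n.
Hypothesis dynamics : arw_dynamics eta gap target pos.

Local Notation rings := (ring_time gap).

Lemma ring_time_lt p n : rings p n < rings p n.+1.
Proof. by rewrite /ring_time [ltRHS]big_ord_recr /= ltrDl. Qed.

Lemma ring_time_gt0 p n : 0 < rings p n.
Proof.
elim: n => [|n IH]; last exact: lt_trans (ring_time_lt p n).
by rewrite /ring_time big_ord_recl big_ord0 addr0.
Qed.

Lemma ring_interval p t :
  t < rings p 0 \/ exists n, rings p n <= t < rings p n.+1.
Proof.
case: (ex_minnP (unbounded p t)) => -[|n] tn nmin; [by left|right; exists n].
by rewrite tn andbT leNgt; apply/negP => /nmin; rewrite ltnn.
Qed.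

Lemma pos_right p t : present eta p -> 0 <= t ->
  exists2 v, t < v & forall s, t <= s < v -> pos p s = pos p t.
Proof.
move=> pp t0; have [pos0 posn] := dynamics pp.
have [tr|[n /andP[nt tn]]] := ring_interval p t.
  exists (rings p 0) => // s /andP[ts sr]; rewrite !pos0 ?t0//.
  by rewrite (le_trans t0).
exists (rings p n.+1) => // s /andP[ts sr].
have nts : rings p n <= s < rings p n.+1 by rewrite (le_trans nt ts).
have [y [_ act inact]] := posn n.
have [a|a] := pselect (active_before eta pos (rings p n) p y).
  by rewrite !(act a)// nt.
by rewrite !(inact a)// nt.
Qed.

Lemma pos_left p t : present eta p -> 0 < t -> (forall n, rings p n <> t) ->
  \forall s \near t^'-, pos p s = pos p t.
Proof.
move=> pp t0 tring; have [pos0 posn] := dynamics pp.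
have [tr|[n /andP[nt tn]]] := ring_interval p t.
  near=> s; have st : s < t by near: s; exact: nbhs_left_lt.
  rewrite !pos0 ?tr ?(ltW t0)//; apply/andP; split; last exact: lt_trans tr.
  by near: s; exact: nbhs_left_ge.
have {}nt : rings p n < t by rewrite lt_neqAle nt andbT; apply/eqP/tring.
near=> s; have st : s < t by near: s; exact: nbhs_left_lt.
have nts : rings p n <= s < rings p n.+1.
  by rewrite (lt_trans st tn) andbT; near: s; exact: nbhs_left_ge.
have ntt : rings p n <= t < rings p n.+1 by rewrite ltW.
have [y [_ act inact]] := posn n.
have [a|a] := pselect (active_before eta pos (rings p n) p y).
  by rewrite !(act a).
by rewrite !(inact a).
Unshelve. all: by end_near. Qed.

Lemma pos_left_limit p t : present eta p -> 0 < t ->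
  exists y, \forall s \near t^'-, pos p s = y.
Proof.
move=> pp t0; have [[n <-]|tring] := pselect (exists n, rings p n = t).
  by have [_ /(_ n)[y []]] := dynamics pp; exists y.
by exists (pos p t); apply: pos_left => // n nt; apply: tring; exists n.
Qed.

Definition occupied t x : Prop := exists2 p, present eta p & pos p t = x.

Section FinitelyManyParticles.
Context (ps : seq (V * nat)).
Hypothesis present_ps : forall p, present eta p -> p \in ps.
Hypothesis distinct : forall p q n m, p <> q -> rings p n <> rings q m.

(* A jump out of [x] requires a second particle at [x], which stays there since
   no two particles ring at the same time. *)
Lemma occupied_le x t u : 0 <= t -> t <= u -> occupied t x -> occupied u x.
Proof.
move=> t0 tu tx; apply: (real_induction (Q := fun u => occupied u x) tu tx).
  move=> s /andP[ts _] [p pp px].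
  have [v sv vp] := pos_right pp (le_trans t0 ts).
  by exists v => // s' s'v; exists p; rewrite ?vp.
move=> {u tu} u /andP[tu _] Qu; have u0 : 0 < u by exact: le_lt_trans tu.
have /choice[y ylim] : forall p, exists y, present eta p -> \forall s \near u^'-, pos p s = y.
  move=> p; have [pp|npp] := pselect (present eta p); last by exists x.
  by have [y] := pos_left_limit pp u0; exists y.
(* With finitely many particles, a single time before [u] shows all left limits at once. *)
have : \forall s \near u^'-, forall p, p \in ps -> present eta p -> pos p s = y p.
  elim: ps => [|p l IH]; first by near=> s.
  have [pp|npp] := pselect (present eta p).
    apply: filterS2 (ylim _ pp) IH => s sp sl q.
    by rewrite inE => /predU1P[->|/sl].
  by apply: filterS IH => s sl q; rewrite inE => /predU1P[->|/sl].
move=> ally; have nearu : \forall s \near u^'-, t <= s < u.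
  by apply: filterS2 (nbhs_left_ge tu) (nbhs_left_lt u) => s -> ->.
have [s [tsu sy]] := at_left_ex2 nearu ally.
have [p pp px] := Qu s tsu.
have yp : y p = x by rewrite -(sy p) ?present_ps.
have [[n nu]|tring] := pselect (exists n, rings p n = u); last first.
  have pleft := pos_left pp u0 (fun n nu => tring (ex_intro _ n nu)).
  have [s' [s'p s'y]] := at_left_ex2 pleft (ylim p pp).
  by exists p; rewrite // -s'p s'y.
have [_ /(_ n)[y' [y'lim act inact]]] := dynamics pp; rewrite nu in y'lim act inact.
have [s' [s'p s'y]] := at_left_ex2 y'lim (ylim p pp).
have nuu : u <= u < rings p n.+1 by rewrite lexx -nu ring_time_lt.
have y'x : y' = x by rewrite -s'p s'y.
have [a|a] := pselect (active_before eta pos u p y'); last first.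
  by exists p => //; rewrite (inact a _ nuu).
have [q [pq qp qy]] := a.
have qleft : \forall s \near u^'-, pos q s = pos q u.
  by apply: pos_left => // m; rewrite -nu; exact: distinct.
have [s'' [s''q s''y]] := at_left_ex2 qleft qy.
by exists q; rewrite // -s''q s''y.
Unshelve. all: by end_near. Qed.

Context (adj : rel V).
Hypothesis adj_sym : symmetric adj.
Hypothesis target_adj : forall p n x, adj x (target p n x).

(* Every vertex that the particle visits before [T] is still occupied at [T]. *)
Lemma particle_stays (C : V -> Prop) T p t : 0 <= T ->
  (forall y z, C y -> adj y z -> occupied T z -> C z) ->
  present eta p -> 0 <= t <= T -> C p.1 <-> C (pos p t).
Proof.
move=> T0 Cadj pp; have visited s : 0 <= s <= T -> occupied T (pos p s).
  by move=> /andP[s0 sT]; apply: (occupied_le s0 sT); exists p.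
have [pos0 posn] := dynamics pp.
(* Induction on the rings of [p]: each one moves it at most along an edge, between two vertices that
   are both occupied at [T]. *)
suff H n s : s < rings p n -> 0 <= s <= T -> C p.1 <-> C (pos p s).
  by have [n tn] := unbounded p t; exact: H n t tn.
elim: n s => [|n IH] s sn sT.
  by have /andP[s0 _] := sT; rewrite pos0// s0.
have [sn'|ns] := ltP s (rings p n); first exact: IH.
have [y [ylim act inact]] := posn n.
have nearn : \forall u \near (rings p n)^'-, 0 <= u < rings p n.
  by apply: filterS2 (nbhs_left_ge (ring_time_gt0 p n)) (nbhs_left_lt _) => u -> ->.
have [u [/andP[u0 un] uy]] := at_left_ex2 nearn ylim.
have uT : 0 <= u <= T.
  by have /andP[_ sT'] := sT; rewrite u0 (le_trans (ltW un))// (le_trans ns).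
have [Cpy Cyp] := IH u un uT; rewrite uy in Cpy Cyp.
have nsn : rings p n <= s < rings p n.+1 by rewrite ns.
have [a|a] := pselect (active_before eta pos (rings p n) p y); last first.
  by rewrite (inact a _ nsn).
have sz := act a _ nsn; split => [/Cpy Cy|Cz].
  by apply: Cadj Cy _ (visited s sT); rewrite sz.
apply: Cyp; apply: Cadj Cz _ _; last by rewrite -uy; exact: visited.
by rewrite sz adj_sym.
Unshelve. all: by end_near. Qed.

(** The set toured is the occupied cluster of [x] at time [T]. Choosing one particle on each of its
    vertices gives distinct particles, all of which started in the cluster by [particle_stays]. *)
Lemma occupied_cluster T x : 0 <= T -> occupied T x -> exists s,
  [/\ path adj x s, (size s <= 2 * size (undup (x :: s)))%N,
    forall y z, y \in x :: s -> adj y z -> occupied T z -> z \in x :: s &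
    (size (undup (x :: s)) <= \sum_(y <- undup (x :: s)) eta y)%N].
Proof.
move=> T0 xT.
have /choice[f fP] : forall y, exists p, occupied T y -> present eta p /\ pos p T = y.
  move=> y; have [[p pp py]|ny] := pselect (occupied T y); first by exists p.
  by exists (x, 0%N).
have f_uniq l : uniq l -> (forall y, y \in l -> occupied T y) -> uniq (map f l).
  move=> ul lT; rewrite map_inj_in_uniq// => y z /lT/fP[_ fy] /lT/fP[_ fz] fyz.
  by rewrite -fy fyz.
(* Each occupied vertex carries its own particle, which supplies the finiteness needed for a
   tour. *)
have bound l : uniq l -> (forall y, y \in l -> occupied T y) -> (size l <= size ps)%N.
  move=> ul lT; rewrite -(size_map f); apply: uniq_leq_size; first exact: f_uniq.
  by move=> p /mapP[y /lT/fP[pp _] ->]; exact: present_ps.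
have [s [xs s2 sT sadj]] := covering_walk adj_sym xT bound.
exists s; split => //; set l := undup (x :: s).
have lT y : y \in l -> occupied T y by rewrite mem_undup; exact: sT.
have -> : \sum_(y <- l) eta y = size [seq (y, i) | y <- l, i <- iota 0 (eta y)].
  rewrite size_allpairs_dep sumnE big_map; apply: eq_bigr => y _.
  by rewrite size_iota.
rewrite -(size_map f); apply: uniq_leq_size; first by rewrite f_uniq ?undup_uniq.
move=> p /mapP[y yl ->]; have [pp py] := fP _ (lT _ yl).
apply/allpairsPdep; exists (f y).1, (f y).2; rewrite mem_iota add0n -surjective_pairing.
split => //; rewrite mem_undup.
have TT : 0 <= T <= T by rewrite T0 lexx.
have := particle_stays (C := fun y => y \in x :: s) T0 sadj pp TT.
by rewrite py => -[_]; apply; rewrite -mem_undup.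
Qed.

End FinitelyManyParticles.
End Trajectories.

(** * Fixation *)

Section Hitting.
Context {R : realType} {V : countType}.

(** An enumeration, with repetitions, of the nonnegative rationals. *)
Definition grid (q : nat * nat) : R := q.1%:R / q.2.+1%:R.

Lemma grid_ge0 q : 0 <= grid q. Proof. by rewrite divr_ge0. Qed.

Lemma grid_dense (t v : R) : 0 <= t -> t < v -> exists q, t < grid q < v.
Proof.
move=> t0; rewrite -subr_gt0 => tv; pose j := Num.bound (v - t)^-1.
have j0 : 0 < j.+1%:R :> R by [].
have jv : 1 < (v - t) * j.+1%:R.
  rewrite -ltr_pdivrMl// mulr1 (lt_le_trans (archi_boundP _)) ?invr_ge0 ?(ltW tv)//.
  by rewrite ler_nat.
have /andP[le lt] := Num.Theory.truncn_itv (mulr_ge0 t0 (ltW j0)).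
exists ((Num.truncn (t * j.+1%:R)).+1, j); rewrite /grid /=.
rewrite ltr_pdivlMr// lt /= ltr_pdivrMr// -natr1.
by move: le; set m := (Num.truncn _)%:R; rewrite mulrBl in jv; lra.
Qed.

(* Observing the process at the countably many times [grid q] keeps the event
   measurable; right continuity of the trajectories makes this sufficient. *)
Definition hit (B : seq V) (T : R) : set (R -> V -> nat) :=
  \bigcap_(x in [set` B]) \bigcup_(q in [set q | grid q <= T])
    [set xi | (0 < xi (grid q) x)%N].

Lemma local_hit B T : local_event (hit B T).
Proof.
exists T, [set` B]; split; first exact: finite_seq.
set G := (G in <<s G>>).
have H : @measurable _ (g_sigma_algebraType G) (hit B T); last exact: H.
apply: (@fin_bigcap_measurable _ (g_sigma_algebraType G)); first exact: finite_seq.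
move=> x xB; rewrite bigcup_mkcond.
apply: (@countable_bigcupT_measurable _ (g_sigma_algebraType G)) => [|q]; first exact: countableP.
case: ifPn => [|_]; last exact: (@measurable0 _ (g_sigma_algebraType G)).
rewrite inE /= => qT.
have -> : [set xi : R -> V -> nat | (0 < xi (grid q) x)%N] =
    ~` [set xi | xi (grid q) x = 0%N].
  by apply/seteqP; split => xi /=; rewrite lt0n => /eqP.
apply: (@measurableC _ (g_sigma_algebraType G)); apply: sub_sigma_algebra.
exists (grid q, x); first by split => //=; rewrite in_itv /= grid_ge0.
by exists 0%N.
Qed.

(** [fset_set] of an infinite set is empty by default, so a positive occupation number also asserts
    finiteness. *)
Lemma occupation_gt0 eta pos t (x : V) : (0 < occupation (R := R) eta pos t x)%N <->
  finite_set (particles_at eta pos t x) /\ occupied eta pos t x.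
Proof.
rewrite /occupation; have [fin|infin] := pselect (finite_set (particles_at eta pos t x)).
  rewrite cardfs_gt0; split => [/fset0Pn[p]|[_ [p pp px]]].
    by rewrite in_fset_set// inE => -[pp px]; split => //; exists p.
  by apply/fset0Pn; exists p; rewrite in_fset_set// inE.
by rewrite /fset_set; case: pselect => // _; rewrite cardfs0; split => // -[].
Qed.

Context {P : V -> V -> R} {eta : V -> nat} (Z : arw_process P eta).
Local Notation Pr := (arw_prob Z).
Local Notation posZ w := (fun p t => arw_pos (a := Z) p t w).
Local Notation occ w := (occupation eta (posZ w)).

Lemma measurable_occupation_gt0 t x : 0 <= t ->
  measurable [set w | (0 < occ w t x)%N].
Proof.
move=> t0.
pose F p : set (arw_space Z) := [set w | present eta p /\ arw_pos (a := Z) p t w = x].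
have mF p : measurable (F p).
  have [pp|npp] := pselect (present eta p).
    rewrite (_ : F p = arw_pos (a := Z) p t @^-1` [set x]); first exact: arw_pos_measurable.
    by apply/seteqP; split => [w []|w wx].
  by rewrite (_ : F p = set0)//; apply/seteqP; split => w // -[].
(* Finiteness of the set of particles at [x] is a countable union over the finite lists that may
   contain it. *)
have -> : [set w | (0 < occ w t x)%N] =
    (\bigcup_(l : seq (V * nat)) \bigcap_(p : V * nat) (~` F p `|` [set w | p \in l]))
    `&` \bigcup_p F p.
  apply/seteqP; split => w /=.
    move=> /occupation_gt0[/finite_seqP[l El] [p pp px]]; split; last by exists p.
    exists l => // q _; have [ql|ql] := boolP (q \in l); [by right|left => Fq].
    by move/negP: ql; apply; suff : [set` l] q by []; rewrite -El.
  move=> [[l _ Fl] [p _ [pp px]]]; apply/occupation_gt0; split; last by exists p.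
  apply: (@sub_finite_set _ _ [set` l]); last exact: finite_seq.
  by move=> q qx; have [/(_ qx)|] := Fl q I.
apply: measurableI; last by apply: countable_bigcupT_measurable => //; exact: countableP.
apply: countable_bigcupT_measurable => [|l]; first exact: countableP.
 rewrite -[X in measurable X]setCK setC_bigcap.
apply: measurableC; apply: countable_bigcupT_measurable => [|p]; first exact: countableP.
apply: measurableC; apply: measurableU; first exact: measurableC.
have [pl|pl] := boolP (p \in l).
  by rewrite (_ : [set w | _] = setT)//; apply/seteqP; split.
by rewrite (_ : [set w | _] = set0)//; apply/seteqP; split.
Qed.

Lemma measurable_hit B T : measurable [set w | hit B T (fun t x => occ w t x)].
Proof.
rewrite (_ : [set w | _] = \bigcap_(x in [set` B]) \bigcup_(q in [set q | grid q <= T])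
    [set w | (0 < occ w (grid q) x)%N]); last by [].
apply: fin_bigcap_measurable; first exact: finite_seq.
move=> x xB; rewrite bigcup_mkcond.
apply: countable_bigcupT_measurable => [|q]; first exact: countableP.
by case: ifPn => // _; apply: measurable_occupation_gt0; exact: grid_ge0.
Qed.

Lemma ae_exists (Q : arw_space Z -> Prop) : {ae Pr, forall w, Q w} -> exists w, Q w.
Proof.
apply: filter_ex; apply: ae_properfilter_algebraOfSetsType.
by rewrite [ltRHS](probability_setT Pr).
Qed.

End Hitting.

Section Segment.
Context {d : nat} (d_gt0 : (0 < d)%N).

Definition segment_point k : 'rV[int]_d :=
  \row_(i < d) (if (i : nat) == 0%N then k%:Z else 0).

Lemma segment_point0 : segment_point 0 = 0.
Proof. by apply/rowP => i; rewrite !mxE; case: ifP. Qed.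

Lemma segment_point_inj : injective segment_point.
Proof.
by move=> j k /rowP/(_ (Ordinal d_gt0)); rewrite !mxE /= => -[].
Qed.

Lemma segment_path n : path (@zd_adj d) 0 [seq segment_point k | k <- iota 1 n].
Proof.
rewrite -segment_point0.
suff H k : path (@zd_adj d) (segment_point k) [seq segment_point k | k <- iota k.+1 n] by exact: H.
elim: n k => [|n IH] k //=; rewrite IH andbT.
rewrite /zd_adj (bigD1 (Ordinal d_gt0))//= !mxE /= big1 ?addr0.
  by apply/eqP; lia.
move=> i i0; rewrite !mxE (_ : ((i : nat) == 0%N) = false) ?subrr ?normr0//.
by apply: contraNF i0 => /eqP ij; apply/eqP/val_inj.
Qed.

Lemma segment_uniq n : uniq (0 :: [seq segment_point k | k <- iota 1 n]).
Proof.
rewrite -segment_point0 -[_ :: _]/[seq segment_point k | k <- iota 0 n.+1].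
by rewrite map_inj_uniq ?iota_uniq//; exact: segment_point_inj.
Qed.

End Segment.

(** * From lightness to fixation *)

Section LightFixating.
Context {R : realType} {d : nat} (d_gt0 : (0 < d)%N).
Local Notation V := 'rV[int]_d.
Context (P : V -> V -> R) (eta : V -> nat) (n : nat).
Hypothesis P_kernel : transition_kernel P.
Hypothesis P_adj : nearest_neighbor (@zd_adj d) P.
Hypothesis eta_light : light eta n.

(** A segment of [n.+1] vertices from the origin: a cluster containing it is large enough for
    [light] to apply. *)
Let B : seq V := 0 :: [seq segment_point k | k <- iota 1 n].

(** Vertices hit by time [T] are still occupied at [T], so the whole segment would lie in the
    origin's cluster. That cluster holds no more vertices than initial particles, against
    lightness. *)
Lemma finite_volume_hit (A : set V) (Z : arw_process P (restrict_to A eta)) T :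
  finite_set A -> 0 <= T -> event_prob Z (hit B T) = 0%E.
Proof.
move=> /finite_seqP[l Al] T0; apply: measure_negligible; first exact: measurable_hit.
set eta' := restrict_to A eta.
have eta'_le x : (eta' x <= eta x)%N by rewrite /eta' /restrict_to; case: ifP.
pose ps := [seq (x, i) | x <- l, i <- iota 0 (eta x)].
have present_ps p : present eta' p -> p \in ps.
  case: p => x i; rewrite /present /eta' /restrict_to /=; case: ifP => // xA ix.
  apply/allpairsPdep; exists x, i; split => //; last by rewrite mem_iota.
  by move: xA; rewrite Al inE.
have facts : {ae arw_prob Z, forall w, [/\
    forall p n, 0 < arw_gap Z p n w,
    forall p M, exists n, M < ring_time (fun p n => arw_gap Z p n w) p n &
    forall p q n m, p <> q -> ring_time (fun p n => arw_gap Z p n w) p n <>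
      ring_time (fun p n => arw_gap Z p n w) q m]}.
  by apply: filterS3 (gap_gt0 Z) (ring_unbounded Z) (ring_distinct Z) => w *; split.
suff : {ae arw_prob Z, forall w,
    ~ hit B T (occupation eta' (fun p t => arw_pos (a := Z) p t w))}.
  by apply: negligibleS => w /= hw nhw; exact: nhw.
apply: filterS3 facts (target_adj Z P_kernel P_adj) (arw_dynamicsP Z).
move=> w [gap0 unb dist] adjw dyn hitw.
set pos := fun p t => arw_pos (a := Z) p t w in dyn hitw.
have occB x : x \in B -> occupied eta' pos T x.
  move=> /hitw[q /= qT /occupation_gt0[_ xq]].
  exact: (occupied_le gap0 unb dyn present_ps dist (grid_ge0 q) qT xq).
have T0B : occupied eta' pos T 0 by apply: occB; rewrite inE eqxx.
have [s [s0 s2 sadj slt]] :=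
  occupied_cluster gap0 unb dyn present_ps dist (@zd_adj_sym d) adjw T0 T0B.
have Bs : {subset B <= 0 :: s}.
  have : path (@zd_adj d) 0 (behead B) by exact: segment_path.
  have : {subset behead B <= B} by move=> x xB; rewrite inE xB orbT.
  have : (0 : V) \in 0 :: s by rewrite inE eqxx.
  suff H (b : seq V) x : x \in 0 :: s -> {subset b <= B} -> path (@zd_adj d) x b ->
      {subset x :: b <= 0 :: s} by exact: H.
  elim: b x => [|y b IH] x xs bB /=; first by move=> _ z; rewrite inE => /eqP ->.
  move=> /andP[xy yb]; have ys : y \in 0 :: s.
    by apply: sadj xs xy _; apply: occB; apply: bB; rewrite inE eqxx.
  have bB' : {subset b <= B} by move=> z zb; apply: bB; rewrite inE zb orbT.
  by move=> z; rewrite inE => /predU1P[->//|zb]; exact: IH zb.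
have : (n <= size (undup (0%R :: s)))%N.
  have sB : {subset B <= undup (0 :: s)} by move=> x xB; rewrite mem_undup; exact: Bs.
  apply: leq_trans (uniq_leq_size (segment_uniq d_gt0 n) sB).
  by rewrite /= size_map size_iota.
move=> /(eta_light s0 s2); rewrite ltnNge => /negP; apply.
by apply: (leq_trans slt); exact: leq_sum.
Qed.

(** Hitting the segment by a fixed time is a local event of probability zero in finite volume, hence
    also in the limit. Nonfixation would make every vertex of the segment occupied at some time. *)
Lemma light_fixating : well_defined P eta -> fixating P eta.
Proof.
move=> [Z lim_Z] /(_ Z lim_Z) nonfix.
pose A m : set V := [set x | (choice.pickle x < m)%N].
have finA m : finite_set (A m).
  apply: (@finite_preimage _ _ `I_m (@choice.pickle V)); last exact: finite_II.
  by move=> x y _ _; exact: (pcan_inj choice.pickleK).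
have [Zm Zm_lim] : exists Zm : forall m, arw_process P (restrict_to (A m) eta),
    forall E, local_event E -> event_prob (Zm m) E @[m --> \oo] --> event_prob Z E.
  apply: lim_Z => // [m x /ltnW//|].
  by apply/seteqP; split => // x _; exists (choice.pickle x).+1 => //=; rewrite /A /=.
have hit0 (T : nat) : event_prob Z (hit B T%:R) = 0%E.
  have := Zm_lim _ (local_hit B T%:R).
  under eq_fun do rewrite finite_volume_hit//.
  by move=> H; exact: (cvg_unique (@ereal_hausdorff R) H (cvg_cst _)).
have nohit : {ae arw_prob Z, forall w, forall T : nat,
    ~ hit B T%:R (occupation eta (fun p t => arw_pos (a := Z) p t w))}.
  apply/ae_foralln => T.
  exists [set w | hit B T%:R (occupation eta (fun p t => arw_pos (a := Z) p t w))].
  split; [exact: measurable_hit|exact: hit0|by move=> w /=; exact: contrapT].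
have facts : {ae arw_prob Z, forall w, [/\
    forall p n, 0 < arw_gap Z p n w,
    forall p M, exists n, M < ring_time (fun p n => arw_gap Z p n w) p n &
    arw_dynamics eta (fun p n => arw_gap Z p n w) (fun p n x => arw_target (a := Z) p n x w)
      (fun p t => arw_pos (a := Z) p t w)]}.
  by apply: filterS3 (gap_gt0 Z) (ring_unbounded Z) (arw_dynamicsP Z) => w *; split.
suff : {ae arw_prob Z, forall w, False} by move=> /ae_exists[].
apply: filterS2 (filterI facts nohit) (filterI nonfix (arw_finite Z)).
move=> w [[gap0 unb dyn] nohitw] [nonfixw finw].
set pos := fun p t => arw_pos (a := Z) p t w in dyn nohitw nonfixw finw.
(* A vertex that is not fixating is visited at some time, and right continuity moves the visit to a
   grid time. *)
have hitx x : exists T : nat, forall T' : R, T%:R <= T' ->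
    exists2 q, grid q <= T' & (0 < occupation eta pos (grid q) x)%N.
  have [t /not_implyP[t0 /contrapT[p [[pp _] px]]]] : exists t,
      ~ (0 <= t -> ~ exists p, active eta pos t p /\ pos p t = x).
    by apply/existsNP => H; apply: (nonfixw x); exists 0.
  have [v tv pv] := pos_right unb dyn pp t0.
  have [q /andP[tq qv]] := grid_dense t0 tv.
  exists (Num.bound (grid q : R)) => T' qT'; exists q.
    by apply: le_trans qT'; exact/ltW/archi_boundP/grid_ge0.
  apply/(occupation_gt0 (R := R)); split; first exact: finw (grid_ge0 q).
  by exists p => //; rewrite pv// ltW.
have /choice[T HT] := hitx.
apply: (nohitw (\max_(x <- B) T x)%N) => x xB.
have [|q qT xq] := HT x (\max_(x <- B) T x)%N%:R; last by exists q.
by rewrite ler_nat; exact: leq_bigmax_seq.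
Qed.

End LightFixating.

(** * Poisson initial occupation *)

(** Since [i! <= (n + i)!], the exponential series from index [n] on is at most
    [mu ^ n * expR mu]. *)
Lemma poisson_tail (R : realType) (mu : R) n : 0 < mu ->
  0 <= 1 - \sum_(i < n) poisson_pmf mu i <= mu ^+ n.
Proof.
move=> mu0; have expR_ge m : \sum_(i < m) mu ^+ i / i`!%:R <= expR mu.
  rewrite -(big_mkord xpredT (fun i => mu ^+ i / i`!%:R)).
  apply: (nondecreasing_cvgn_le (u_ := series (exp_coeff mu))).
    by apply: nondecreasing_series => i _ _; exact: exp_coeff_ge0 (ltW mu0).
  exact: is_cvg_series_exp_coeff.
have expR_le : expR mu <= \sum_(i < n) mu ^+ i / i`!%:R + mu ^+ n * expR mu.
  apply: limr_le; first exact: is_cvg_series_exp_coeff.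
  near=> m; have nm : (n <= m)%N by near: m; exact: nbhs_infty_ge.
  rewrite /series /= (big_cat_nat (leq0n n) nm) /= big_mkord lerD2l.
  rewrite -{1}(add0n n) big_addn big_mkord.
  apply: le_trans (ler_wpM2l (exprn_ge0 n (ltW mu0)) (expR_ge (m - n)%N)).
  rewrite mulr_sumr; apply: ler_sum => i _.
  rewrite /exp_coeff /= addnC exprD -mulrA ler_pM2l ?exprn_gt0// ler_pM2l ?exprn_gt0//.
  by rewrite lef_pV2 ?posrE ?ltr0n ?fact_gt0// ler_nat leq_fact// leq_addl.
rewrite /poisson_pmf mu0 -mulr_suml expRN.
have e0 := expR_gt0 mu; move: (expR_ge n) expR_le; set S := \sum_(i < n) _ => Se eS.
rewrite subr_ge0 ler_pdivrMr// mul1r Se /=.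
rewrite -(ler_pM2r e0) mulrBl mul1r -mulrA mulVf ?gt_eqF// mulr1.
by rewrite lerBlDl.
Unshelve. all: by end_near. Qed.

Lemma poisson_small (R : realType) (D : nat) (c : R) : (0 < D)%N -> 0 < c ->
  exists2 mu0 : R, 0 < mu0 & forall mu, 0 < mu < mu0 ->
    (\sum_(0 <= k <oo) ((1 - \sum_(i < k.+1) poisson_pmf mu i) `^ (D%:R^-1))%:E < c%:E)%E.
Proof.
(* This value makes both [2 * r0 <= c] and [r0 <= 1/2] hold. *)
move=> D0 c0; pose r0 : R := c / (2 * (1 + c)).
have r00 : 0 < r0 by rewrite divr_gt0// mulr_gt0// addr_gt0.
exists (Num.min 1 (r0 ^+ D)); first by rewrite lt_min ltr01 exprn_gt0.
move=> mu; rewrite lt_min => /and3P[mu0 mu1 muD].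
pose r := mu `^ D%:R^-1.
have rD : r ^+ D = mu.
  by rewrite -powR_mulrn ?powR_ge0// -powRrM mulVf ?powRr1 ?ltW// pnatr_eq0 -lt0n.
have r_gt0 : 0 < r by exact: powR_gt0.
have rr0 : r < r0 by rewrite -(@ltr_pXn2r _ D) ?nnegrE ?ltW// rD.
have c1 : 0 < 2 * (1 + c) by lra.
have r0c : 2 * r0 <= c by rewrite /r0 mulrA ler_pdivrMr//; nra.
have r2 : r <= 2^-1.
  by rewrite (ltW (lt_le_trans rr0 _))// /r0 ler_pdivrMr//; lra.
apply: (@le_lt_trans _ _ (2 * r)%:E); last by rewrite lte_fin; lra.
(* The [D]-th roots of the tails are dominated by a geometric series, whose sum is at most [2 * r]
   because [r <= 1/2]. *)
apply: (@le_trans _ _ (\sum_(0 <= k <oo) (r ^+ k.+1)%:E)%E).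
  apply: lee_nneseries => k _; first by move=> _; rewrite lee_fin powR_ge0.
  have /andP[t0 t1] := poisson_tail k.+1 mu0; rewrite lee_fin.
  rewrite (le_trans (ge0_ler_powR _ _ _ t1)) ?nnegrE ?exprn_ge0 ?(ltW mu0)//.
  rewrite -rD -exprM mulnC exprM -powR_mulrn ?exprn_ge0 ?(ltW r_gt0)//.
  by rewrite -powRrM divff ?powRr1 ?exprn_ge0 ?(ltW r_gt0)// pnatr_eq0 -lt0n.
apply: lime_le.
  by apply: is_cvg_nneseries => k _ _; rewrite lee_fin exprn_ge0// ltW.
apply: nearW => N; rewrite sumEFin lee_fin big_mkord.
have : (\sum_(k < N) r ^+ k.+1) * (1 - r) = r - r ^+ N.+1.
  elim: N => [|N IH]; first by rewrite big_ord0 mul0r expr1 subrr.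
  by rewrite big_ord_recr /= mulrDl IH !exprS; ring.
have := exprn_gt0 N.+1 r_gt0; move: (r ^+ N.+1) (\sum_(k < N) _) => a S.
by clear -r_gt0 r2; nra.
Qed.

(** Keeping the exponent [D] apart from the dimension serves both halves of the theorem: [D = d] for
    the tail condition, [D = maxn 2 d] for the Poisson law. *)
Lemma iid_fixating (R : realType) (d D : nat) : (0 < d)%N -> (2 <= D)%N -> (d <= D)%N ->
  forall (pmf : nat -> R),
  (\sum_(0 <= k <oo) ((1 - \sum_(i < k.+1) pmf i) `^ (D%:R^-1))%:E <
     (greedy_const (R := R) (d := d))%:E)%E ->
  forall (P : 'rV[int]_d -> 'rV[int]_d -> R),
    transition_kernel P -> nearest_neighbor (@zd_adj d) P ->
  forall (dO : measure_display) (Omega : measurableType dO)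
    (Pr : probability Omega R) (eta0 : 'rV[int]_d -> {RV Pr >-> nat}),
    iid_pmf eta0 pmf ->
    {ae Pr, forall w, well_defined P (fun x => eta0 x w)} ->
    {ae Pr, forall w, fixating P (fun x => eta0 x w)}.
Proof.
move=> d0 D2 dD pmf sum_lt P PK Padj dO Omega Pr eta0 iid.
apply: filterS2 (light_ae D2 dD iid sum_lt) => w [n ln].
exact: (light_fixating d0 PK Padj ln).
Qed.

Theorem corollary4p4 (R : realType) :
  (forall d : nat, (2 <= d)%N ->
    exists2 c : R, 0 < c &
      forall (D : nat -> R),
        is_pmf D ->
        (\sum_(0 <= n <oo)
           ((1 - \sum_(i < n.+1) D i) `^ (d%:R^-1))%:E < c%:E)%E ->
      forall (P : 'rV[int]_d -> 'rV[int]_d -> R),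
        transition_kernel P -> nearest_neighbor (@zd_adj d) P ->
      forall (dO : measure_display) (Omega : measurableType dO)
        (Pr : probability Omega R) (eta0 : 'rV[int]_d -> {RV Pr >-> nat}),
        iid_pmf eta0 D ->
        {ae Pr, forall w, well_defined P (fun x => eta0 x w)} ->
        {ae Pr, forall w, fixating P (fun x => eta0 x w)}) /\
  (forall d : nat, (0 < d)%N ->
    forall (P : 'rV[int]_d -> 'rV[int]_d -> R),
      transition_kernel P -> nearest_neighbor (@zd_adj d) P ->
      (forall mu : R, 0 < mu ->
        poisson_almost_surely mu (well_defined P)) ->
      (0 < critical_density P)%E).
Proof.
split => d d0.
  exists (greedy_const (R := R) (d := d)); first exact: greedy_const_gt0.
  move=> D _; apply: iid_fixating => //; exact: ltnW.
(* In dimension one the exponent is raised to two, as the estimate below the block scale requires;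
   small Poisson densities still satisfy the tail condition by [poisson_small]. *)
move=> P PK Padj wd; pose D := maxn 2 d.
have D2 : (2 <= D)%N by exact: leq_maxl.
have dD : (d <= D)%N by exact: leq_maxr.
have [mu0 mu00 small] := poisson_small (ltnW D2) (greedy_const_gt0 (R := R) (d := d)).
apply: (@lt_le_trans _ _ mu0%:E); first by rewrite lte_fin.
apply: ereal_sup_ubound; exists mu0 => //; split; first exact: ltW.
move=> mu mu_lt dO Omega Pr eta0 iid; have /andP[mu_gt0 _] := mu_lt.
apply: (iid_fixating d0 D2 dD (small mu mu_lt) PK Padj iid).
exact: (wd mu mu_gt0 _ _ _ _ iid).
Qed.
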